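(* For $n\ge 3$ the following three statements are equivalent. (i) $n$ is a power of an odd prime or $n$ is the product of at most $3$ (not necessarily distinct) odd primes. (ii) For every $E\subseteq\mathbb{Z}_n$, the support of $\widehat{\chi_E}$ is an extendable domain. (iii) If for some nonempty $E\subseteq\mathbb{Z}_n$ and some $g:\mathbb{Z}_n\to\mathbb{R}$ the functions $\chi_E$ and $g$ have the same $3$-deck, then they are translates of each other (i.e. $g(x)=\chi_E(x-t)$ for all $x$, for some $t\in\mathbb{Z}_n$).
   Context: For $f:\mathbb{Z}_n\to\mathbb{R}$, the $3$-deck is $N_{f,3}(x_1,x_2)=\sum_{x\in\mathbb{Z}_n} f(x)f(x+x_1)f(x+x_2)$. The Fourier transform of $f:\mathbb{Z}_n\to\mathbb{C}$ is $\widehat f(k)=\sum_{j=0}^{n-1}f(j)e^{-2\pi i jk/n}$, $k\in\mathbb{Z}_n$, and $\mathrm{supp}\,\widehat f=\{k:\widehat f(k)\ne0\}$. A set $A\subseteq\mathbb{Z}_n$ is an extendable domain if for every function $h:A\to\mathbb{R}/\mathbb{Z}$ that is additive (i.e. $h(x+y)=h(x)+h(y)$ whenever $x,y,x+y\in A$) there exists $L\in\mathbb{R}$ with $h(k)=Lk \pmod 1$ for every $k\in A$. *)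

(* Defs.v *)
From mathcomp Require Import all_boot all_order all_algebra.
From mathcomp Require Import reals trigo.
From mathcomp Require Import complex.

Set Implicit Arguments.
Unset Strict Implicit.
Unset Printing Implicit Defensive.

Import Order.TTheory GRing.Theory Num.Theory.
Local Open Scope ring_scope.
Local Open Scope complex_scope.
Local Open Scope quotient_scope.

(* R / Z: quotient of the additive group of R by the subgroup of integers;
   int_num_subdef is the predicate underlying the qualifier Num.int. *)
Definition int_subgroup (R : realType) : zmodClosed R :=
  (Num.int_num_subdef : {pred R}).
Definition circle (R : realType) := Quotient.quot (int_subgroup R).

Definition mod1 (R : realType) (x : R) : circle R := \pi_(circle R) x.

Lemma mod1_eq (R : realType) (x y : R) :
  (mod1 x = mod1 y) <-> (x - y \is a Num.int).
Proof.
rewrite /mod1 /circle Quotient.idealrBE; split=> [->|/eqP]; by [rewrite eqxx|].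
Qed.

Lemma mod1D (R : realType) (x y : R) : mod1 (x + y) = mod1 x + mod1 y.
Proof. exact: (@Quotient.pi_add R (int_subgroup R)). Qed.

Definition chi (R : realType) (n : nat) (E : {set 'Z_n}) (x : 'Z_n) : R :=
  (x \in E)%:R.
Arguments chi R {n} E x.

Definition deck3 (R : realType) (n : nat) (f : 'Z_n -> R) (x1 x2 : 'Z_n) : R :=
  \sum_(x : 'Z_n) f x * f (x + x1) * f (x + x2).

(* exp (i t) *)
Definition cis (R : realType) (t : R) : R[i] := cos t +i* sin t.

Definition dft (R : realType) (n : nat) (f : 'Z_n -> R[i]) (k : 'Z_n) : R[i] :=
  \sum_(j : 'Z_n)
     f j * cis (- (2 * pi * (j : nat)%:R * (k : nat)%:R / n%:R)).

Definition dft_supp (R : realType) (n : nat) (f : 'Z_n -> R[i]) : {set 'Z_n} :=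
  [set k | dft f k != 0].

(* A map A -> R / Z is represented by a total map whose values outside A are
   irrelevant: they occur neither here nor in extendable_domain. *)
Definition additive_on (R : realType) (n : nat) (A : {set 'Z_n})
    (h : 'Z_n -> circle R) : Prop :=
  forall x y, x \in A -> y \in A -> x + y \in A -> h (x + y) = h x + h y.

(* Since L is an arbitrary real, L k mod 1 depends on the representative of k;
   the one taken is in {0, ..., n - 1}. *)
Definition extendable_domain (R : realType) (n : nat) (A : {set 'Z_n}) : Prop :=
  forall h : 'Z_n -> circle R, additive_on A h ->
    exists L : R, forall k, k \in A -> h k = mod1 (L * (k : nat)%:R).
Arguments extendable_domain R {n} A.

Definition odd_prime_power (n : nat) : Prop :=
  exists p k : nat, [/\ prime p, odd p & n = (p ^ k)%N].

Definition product_of_at_most_3_odd_primes (n : nat) : Prop :=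
  exists s : seq nat,
    [/\ (size s <= 3)%N, {in s, forall p, prime p && odd p}
      & n = (\prod_(p <- s) p)%N].

(* Main.v *)
(* With e(x) = exp(-2 pi i x / n), equality of 3-decks says that the products
   f^(k) f^(l) f^(-k-l) agree; for f = chi_E this makes g^/f^ a unimodular
   function on the support whose phase is additive there, and (ii) <-> (iii) is
   the statement that such a phase is linear.

   (i) -> (ii).  As the cyclotomic polynomials are irreducible, the support is a
   union of classes {k | gcd(k, n) = g}.  For odd n an additive h is linear on
   each class, h(g x) = x h(g), and it is linear on the whole support as soon as
   the values h(g), h(g') agree on common multiples of g and g' for all classes
   g, g'.  If n has at most three prime factors the only doubtful case is that of
   two distinct primes g, g' with n = g g' r.  If neither the class 1 nor g g'
   nor r meets the support, then E is, on each coset of the subgroup of order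
   g g', invariant under the subgroup of order g or that of order g', and meets
   all these cosets in the same number of points; as g and g' are coprime, one
   of the two types occurs throughout, and then g or g' is not in the support.

   (ii) -> (i).  For n = 2m the interval [0, m) has a support consisting of 0 and
   odd numbers, on which additivity says no more than h(-k) = -h(k).
   For n = p p' q l with p, q coprime and p' not dividing q, let
   E = {i l + y n/q} u {1 + i l + y n/p} with i < p'.  A k in the support is
   divisible by p or by q, and by p p' q if by both, so k / (p p') on the
   multiples of q not divisible by p, extended by 0, is additive; it is not
   linear. *)
Require Import Defs.
From mathcomp Require Import all_boot all_order all_algebra all_field.
From mathcomp Require Import reals trigo.
From mathcomp Require Import complex.
From mathcomp Require Import ring lra zify.

Set Implicit Arguments.
Unset Strict Implicit.
Unset Printing Implicit Defensive.

Import Order.TTheory GRing.Theory Num.Theory.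
Local Open Scope ring_scope.
Local Open Scope complex_scope.

(** * Fourier analysis on Z_n *)

Section Cis.
Variable R : realType.
Implicit Types s t : R.

Lemma cis0 : cis (0 : R) = 1.
Proof. by rewrite /cis cos0 sin0. Qed.

Lemma cisD s t : cis (s + t) = cis s * cis t.
Proof. by apply/eqP; rewrite eq_complex /= cosD sinD; apply/andP; split; apply/eqP; ring. Qed.

Lemma cis_neq0 t : cis t != 0.
Proof.
apply/eqP => z; have := cisD t (- t); rewrite subrr cis0 z mul0r.
by move/eqP; rewrite oner_eq0.
Qed.

Lemma cisN t : cis (- t) = (cis t)^-1.
Proof.
by apply: (mulfI (cis_neq0 t)); rewrite -cisD subrr cis0 mulfV ?cis_neq0.
Qed.

Lemma conj_cis t : ((cis t)^*)%R = cis (- t).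
Proof. by rewrite /cis cosN sinN. Qed.

Lemma cis_mulrn t m : cis (t *+ m) = cis t ^+ m.
Proof.
elim: m => [|m IH]; first by rewrite mulr0n cis0.
by rewrite mulrS cisD IH exprS.
Qed.

Lemma cis_2pi_int (t : R) : t \is a Num.int -> cis (2 * pi * t) = 1.
Proof.
have c1 : cis (2 * pi : R) = 1 by rewrite mulr_natl /cis cos2pi sin2pi.
have nat1 (m : nat) : cis (2 * pi * m%:R : R) = 1.
  by rewrite mulr_natr cis_mulrn c1 expr1n.
case/intrP => -[m|m] ->; first exact: nat1.
by rewrite NegzE rmorphN mulrN cisN nat1 invr1.
Qed.

Lemma cos_lt1 t : 0 < t < 2 * pi -> cos t < 1.
Proof.
move=> /andP[t0 t2]; have pi0 := @pi_gt0 R.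
have aux u : 0 < u <= pi -> cos u < 1.
  move=> /andP[u0 u1]; rewrite -[1]cos0 ltr_cos ?in_itv /= ?lexx ?(ltW u0) ?u1 //.
  exact: pi_ge0.
have [tp|tp] := leP t pi; first by apply: aux; rewrite t0.
rewrite -cosN -cosD2pi; apply: aux; rewrite -mulr_natl.
by apply/andP; split; lra.
Qed.

Lemma cis_eq1 t : cis (2 * pi * t) = 1 -> t \is a Num.int.
Proof.
move=> h; have pi0 := @pi_gt0 R.
pose f := t - (Num.floor t)%:~R.
have f0 : 0 <= f by rewrite subr_ge0 floor_le.
have f1 : f < 1.
  have := floorD1_gt t; rewrite /f intrD; lra.
have cf : cis (2 * pi * f) = 1.
  by rewrite /f mulrBr cisD cisN h cis_2pi_int ?invr1 ?mulr1 // intr_int.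
have [fz|fn] := eqVneq f 0; first by rewrite -(subr0 t) -fz /f subKr intr_int.
suff : cos (2 * pi * f) < 1 by case: cf => -> _; rewrite ltxx.
have p2 : 0 < 2 * pi :> R by rewrite mulr_gt0.
apply: cos_lt1; rewrite mulr_gt0 //= ?gtr_pMr //.
by rewrite lt0r fn.
Qed.

Lemma cis_surj (z : R[i]) : z * z^* = 1 -> exists t, z = cis (2 * pi * t).
Proof.
case: z => a b [h _].
have {}h : a ^+ 2 + b ^+ 2 = 1 by rewrite -h; ring.
have a1 : -1 <= a <= 1.
  have : `|a| <= 1 by rewrite -(expr_le1 (n:=2)) // real_normK ?num_real // -h lerDl sqr_ge0.
  by rewrite ler_norml.
have pi0 := @pi_gt0 R.
have e (u : R) : 2 * pi * (u / (2 * pi)) = u 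
  by rewrite mulrC divfK //; apply: lt0r_neq0; apply: mulr_gt0.
have s : sin (acos a) = `|b|.
  rewrite sin_acos // (_ : 1 - a ^+ 2 = b ^+ 2) ?sqrtr_sqr //.
  by rewrite -h; ring.
have [b0|b0] := leP 0 b.
  by exists (acos a / (2 * pi)); rewrite e /cis acosK ?in_itv // s ger0_norm.
exists (- acos a / (2 * pi)); rewrite e /cis cosN sinN acosK ?in_itv // s.
by rewrite ltr0_norm // opprK.
Qed.

End Cis.

Section Fourier.
Variables (R : realType) (n : nat).
Hypothesis n_gt1 : (1 < n)%N.
Implicit Types (x y k l : 'Z_n) (f : 'Z_n -> R[i]).

Let n_gt0 : (0 < n)%N. Proof. exact: ltnW. Qed.

Definition zroot : R[i] := cis (- (2 * pi / n%:R)).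

Lemma zrootX m : zroot ^+ m = cis (- (2 * pi * (m%:R / n%:R))).
Proof.
rewrite /zroot -cis_mulrn; move: (2 * pi) => c.
by rewrite [m%:R / _]mulr_natl mulrnAr mulNrn.
Qed.

Lemma zroot_prim : n.-primitive_root zroot.
Proof.
apply/andP; split; first exact: n_gt0.
apply/forallP => i; apply/eqP; rewrite unity_rootE.
have nz : n%:R != 0 :> R by rewrite pnatr_eq0 -lt0n.
apply/eqP/idP => [|/eqP i1]; last first.
  by rewrite zrootX i1 divff // mulr1 cisN -[2 * pi]mulr1 cis_2pi_int ?invr1 ?rpred1.
rewrite zrootX -mulrN => /cis_eq1; rewrite rpredN => /intrP[m] /(canRL (divfK nz)) e.
have {}e : (i.+1%:Z = m * n%:Z)%R.
  by apply: (@intr_inj R); rewrite intrM -!pmulrn.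
have : (n %| i.+1)%N by rewrite -[i.+1]/(`|i.+1%:Z|%N) e abszM dvdn_mull.
by move/dvdn_leq => /(_ isT) h; rewrite eqn_leq ltn_ord.
Qed.

Lemma zroot_neq0 : zroot != 0.
Proof. exact: cis_neq0. Qed.

Definition ech x : R[i] := zroot ^+ x.

Lemma val_natZ m : (m%:R : 'Z_n) = (m %% n)%N :> nat.
Proof. exact: val_Zp_nat. Qed.

Lemma ltZ x : (x < n)%N.
Proof. by have := ltn_ord x; rewrite [X in (_ < X)%N](Zp_cast n_gt1). Qed.

(** Representatives are added in [nat], without reduction. Applied to [k] and [- k], this turns
    [h k + h (- k) = 0] into the integrality of [L * n]. *)
Lemma addn_oppZ x : x != 0 -> (x + (- x)%R)%N = n.
Proof.
move=> x0; rewrite /= -[RHS](Zp_cast n_gt1).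
have x1 : (0 < x)%N by rewrite lt0n; apply: contra x0 => /eqP e; apply/eqP/val_inj.
by rewrite modn_small ?subnKC ?(ltnW (ltn_ord x)) // ltn_subrL x1.
Qed.

Lemma val_addZ x y : (x + y : 'Z_n) = ((x + y) %% n)%N :> nat.
Proof. by rewrite -{1}[x]natr_Zp -{1}[y]natr_Zp -natrD val_natZ. Qed.

Lemma ech_nat m : ech m%:R = zroot ^+ m.
Proof. by rewrite /ech val_natZ (prim_expr_mod zroot_prim). Qed.

Lemma echD x y : ech (x + y) = ech x * ech y.
Proof. by rewrite -[x]natr_Zp -[y]natr_Zp -natrD !ech_nat exprD. Qed.

Lemma ech0 : ech 0 = 1.
Proof. by rewrite -[0]/(0%:R) ech_nat. Qed.

Lemma ech_neq0 x : ech x != 0.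
Proof. by rewrite expf_neq0 // zroot_neq0. Qed.

Lemma echN x : ech (- x) = (ech x)^-1.
Proof. by apply: (mulfI (ech_neq0 x)); rewrite -echD subrr ech0 mulfV ?ech_neq0. Qed.

Lemma conj_ech x : ((ech x)^*)%R = ech (- x).
Proof.
by rewrite echN /ech zrootX conj_cis -cisN.
Qed.

Lemma ech_eq1 x : ech x = 1 -> x = 0.
Proof.
move/eqP; rewrite -(prim_order_dvd zroot_prim) => h.
apply: val_inj => /=; apply/eqP; move: h.
by rewrite /dvdn modn_small // ltZ.
Qed.

Lemma ech_mulrn x m : ech (x * m%:R) = ech x ^+ m.
Proof. by rewrite -{1}[x]natr_Zp -natrM ech_nat exprM. Qed.

Lemma dftE f k : dft f k = \sum_j f j * ech (j * k).
Proof.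
apply: eq_bigr => j _; congr (_ * _).
rewrite -[j in RHS]natr_Zp -[k in RHS]natr_Zp -natrM ech_nat zrootX; congr cis.
by rewrite natrM !mulrA.
Qed.

Lemma sum_ech x : \sum_k ech (k * x) = n%:R *+ (x == 0).
Proof.
have [->|xn] := eqVneq x 0.
  rewrite (eq_bigr (fun _ => 1)) => [|k _]; last by rewrite mulr0 ech0.
  by rewrite sumr_const card_ord Zp_cast.
set S := \sum_k _; have : S = S * ech x.
  rewrite {1}/S (reindex_inj (addrI 1)) mulr_suml /=.
  by apply: eq_bigr => k _; rewrite mulrDl mul1r echD mulrC.
move/eqP; rewrite -subr_eq0 -{1}[S]mulr1 -mulrBr mulf_eq0 subr_eq0 => /orP[/eqP->//|].
by rewrite eq_sym => /eqP/ech_eq1 x0; rewrite x0 eqxx in xn.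
Qed.

Let nC : n%:R != 0 :> R[i]. Proof. by rewrite pnatr_eq0 -lt0n. Qed.

Definition idft f x : R[i] := n%:R^-1 * \sum_k f k * ech (- (k * x)).

Lemma dftK f : idft (dft f) =1 f.
Proof.
move=> x; rewrite /idft.
under eq_bigr do rewrite dftE mulr_suml.
rewrite exchange_big (bigD1 x) //= [X in _ + X]big1 ?addr0 => [|y yx].
  under eq_bigr do rewrite -mulrA -echD (mulrC _ x) subrr ech0 mulr1.
  by rewrite sumr_const card_ord (Zp_cast n_gt1) -[f x *+ n]mulr_natl mulKf.
under eq_bigr => k _ do rewrite -mulrA -echD mulrC -(mulrC k) -mulrBr.
by rewrite -mulr_suml sum_ech subr_eq0 (negPf yx) mulr0n mul0r.
Qed.

Lemma idftK f : dft (idft f) =1 f.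
Proof.
move=> x; rewrite dftE /idft.
under eq_bigr do rewrite -mulrA mulr_suml.
rewrite -mulr_sumr exchange_big (bigD1 x) //= [X in _ + X]big1 ?addr0 => [|y yx].
  under eq_bigr do rewrite -mulrA -echD (mulrC x) addNr ech0 mulr1.
  by rewrite sumr_const card_ord (Zp_cast n_gt1) -[f x *+ n]mulr_natl mulKf.
under eq_bigr => k _ do rewrite -mulrA -echD mulrC (mulrC y) addrC -mulrBr.
by rewrite -mulr_suml sum_ech subr_eq0 eq_sym (negPf yx) mulr0n mul0r.
Qed.

Lemma dft_inj f g : dft f =1 dft g -> f =1 g.
Proof.
move=> e x; rewrite -dftK -[RHS]dftK /idft; congr (_ * _).
by apply: eq_bigr => k _; rewrite e.
Qed.

Lemma dft_eq0 f : (forall k, dft f k = 0) -> forall x, f x = 0.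
Proof.
move=> e; apply: (@dft_inj f (fun=> 0)) => k; rewrite e.
by rewrite dftE big1 // => j _; rewrite mul0r.
Qed.

Lemma dft_shift f a k : dft (fun x => f (x + a)) k = dft f k * ech (- (a * k)).
Proof.
rewrite !dftE mulr_suml (reindex_inj (addIr (- a))).
by apply: eq_bigr => j _; rewrite subrK -mulrA -echD mulrBl.
Qed.

Lemma dftB f g k : dft (fun x => f x - g x) k = dft f k - dft g k.
Proof. by rewrite !dftE -sumrB; apply: eq_bigr => j _; rewrite mulrBl. Qed.

Lemma dft_sum (I : Type) (r : seq I) (P : pred I) (F : I -> 'Z_n -> R[i]) k :
  dft (fun x => \sum_(i <- r | P i) F i x) k = \sum_(i <- r | P i) dft (F i) k.
Proof.
rewrite dftE; under eq_bigr do rewrite mulr_suml.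
by rewrite exchange_big; apply: eq_bigr => i _; rewrite dftE.
Qed.

Lemma conj_dft (f : 'Z_n -> R) k :
  ((dft (fun x => (f x)%:C) k)^*)%R = dft (fun x => (f x)%:C) (- k).
Proof.
rewrite !dftE raddf_sum; apply: eq_bigr => j _ /=.
by rewrite rmorphM mulrN -conj_ech; congr (_ * _); exact: conjc_real.
Qed.

Definition cdeck3 f x1 x2 : R[i] := \sum_x f x * f (x + x1) * f (x + x2).

Lemma cdeck3_real (f : 'Z_n -> R) x1 x2 :
  cdeck3 (fun x => (f x)%:C) x1 x2 = (deck3 f x1 x2)%:C.
Proof. by rewrite /deck3 rmorph_sum; apply: eq_bigr => x _; rewrite !rmorphM. Qed.

(** Transforming in [x2] and in [x1] a factor shifted by [x] gives [dft f l] and [dft f k], each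
    times a character of [x]; the sum over [x] that is left is the transform of [f] at [- k - l]. *)
Lemma cdeck3_dft f k l :
  dft (fun x1 => dft (cdeck3 f x1) l) k = dft f k * dft f l * dft f (- k - l).
Proof.
rewrite dftE; under eq_bigr => x1 _.
  rewrite dftE /cdeck3; under eq_bigr do rewrite mulr_suml.
  rewrite exchange_big mulr_suml; under eq_bigr => x _.
    under eq_bigr do rewrite -mulrA.
    rewrite -mulr_sumr -(dftE (fun y => f (x + y))).
    rewrite (_ : dft _ l = dft f l * ech (- (x * l))); last first.
      by rewrite -dft_shift; apply: eq_bigr => y _; rewrite addrC.
    over.
  over.
rewrite exchange_big /= (eq_bigr (fun x => dft f l * dft f k * (f x * ech (x * (- k - l))))).
  by rewrite -mulr_sumr -dftE (mulrC (dft f l)).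
move=> x _; under eq_bigr => y _.
  rewrite (_ : _ * _ = (f x * (dft f l * ech (- (x * l)))) * (f (x + y) * ech (y * k))).
    over.
  by ring.
rewrite -mulr_sumr -(dftE (fun y => f (x + y))).
rewrite (_ : dft _ k = dft f k * ech (- (x * k))); last first.
  by rewrite -dft_shift; apply: eq_bigr => y _; rewrite addrC.
by rewrite mulrBr mulrN echD; ring.
Qed.

Lemma cdeck3_eqP f g :
  (forall x1 x2, cdeck3 f x1 x2 = cdeck3 g x1 x2) <->
  (forall k l, dft f k * dft f l * dft f (- k - l)
             = dft g k * dft g l * dft g (- k - l)).
Proof.
split=> e.
  move=> k l; rewrite -!cdeck3_dft; apply: eq_bigr => x1 _; congr (_ * _).
  by apply: eq_bigr => x2 _; rewrite e.
move=> x1; apply: dft_inj => l; move: x1; apply: dft_inj => k.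
by rewrite !cdeck3_dft.
Qed.

End Fourier.

(** * The circle and the equivalence of (ii) and (iii) *)

Section Circle.
Variable R : realType.
Implicit Types (s t : R) (u v : circle R).

Lemma mod1_eq0 t : mod1 t = 0 <-> t \is a Num.int.
Proof.
have m0 : mod1 (0 : R) = 0 by apply: (addrI (mod1 0)); rewrite -mod1D !addr0.
by rewrite -m0 mod1_eq subr0.
Qed.

Lemma mod1_0 : mod1 (0 : R) = 0.
Proof. by apply/mod1_eq0; rewrite rpred0. Qed.

Lemma mod1N t : mod1 (- t) = - mod1 t.
Proof. by apply: (addrI (mod1 t)); rewrite -mod1D !subrr mod1_0. Qed.

Lemma mod1_mulrn t m : mod1 (t *+ m) = mod1 t *+ m.
Proof. by elim: m => [|m IH]; rewrite ?mod1_0 // !mulrS mod1D IH. Qed.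

Lemma mod1_surj u : exists t, u = mod1 t.
Proof. by exists (repr u); rewrite /mod1 reprK. Qed.

Lemma circle_divisible u m : (0 < m)%N -> exists v, v *+ m = u.
Proof.
move=> m0; have [t ->] := mod1_surj u; exists (mod1 (t / m%:R)).
by rewrite -mod1_mulrn -[_ / _ *+ m]mulr_natr divfK // pnatr_eq0 -lt0n.
Qed.

(** The isomorphism of R / Z with the unit circle; the choice of lift made by [repr] is harmless by
    [cis_2pi_int]. *)
Definition cexp u : R[i] := cis (2 * pi * repr u).

Lemma cexp_mod1 t : cexp (mod1 t) = cis (2 * pi * t).
Proof.
rewrite /cexp -[in LHS](subrK t (repr _)) mulrDr cisD cis_2pi_int ?mul1r //.
by rewrite -mod1_eq /mod1 reprK.
Qed.

Lemma cexpD u v : cexp (u + v) = cexp u * cexp v.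
Proof.
have [s ->] := mod1_surj u; have [t ->] := mod1_surj v.
by rewrite -mod1D !cexp_mod1 mulrDr cisD.
Qed.

Lemma cexp0 : cexp 0 = 1.
Proof. by rewrite -mod1_0 cexp_mod1 mulr0 cis0. Qed.

Lemma cexp_neq0 u : cexp u != 0.
Proof. exact: cis_neq0. Qed.

Lemma cexpN u : cexp (- u) = (cexp u)^-1.
Proof.
by apply: (mulfI (cexp_neq0 u)); rewrite -cexpD subrr cexp0 mulfV ?cexp_neq0.
Qed.

Lemma conj_cexp u : ((cexp u)^*)%R = cexp (- u).
Proof. by rewrite cexpN /cexp conj_cis cisN. Qed.

Lemma cexp_inj : injective cexp.
Proof.
move=> u v; have [s ->] := mod1_surj u; have [t ->] := mod1_surj v => e.
apply/mod1_eq; apply: cis_eq1.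
by rewrite mulrBr cisD cisN -!cexp_mod1 e mulfV ?cexp_neq0.
Qed.

Lemma cexp_surj (z : R[i]) : z * z^* = 1 -> exists u, z = cexp u.
Proof. by case/cis_surj => t ->; exists (mod1 t); rewrite cexp_mod1. Qed.

Lemma cexp_ratio (a b : R[i]) :
  b != 0 -> a * a^* = b * b^* -> exists u, a = b * cexp u.
Proof.
move=> b0 e; have [|u uE] := cexp_surj (z := a / b).
  by rewrite rmorphM fmorphV mulrACA -invfM e mulfV // mulf_neq0 // conjC_eq0.
by exists u; rewrite -uE mulrC divfK.
Qed.

End Circle.

Section DeckExtendable.
Variables (R : realType) (n : nat).
Hypothesis n_gt1 : (1 < n)%N.
Implicit Types (x y k l : 'Z_n) (E : {set 'Z_n}) (g : 'Z_n -> R).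

Let chiC E : 'Z_n -> R[i] := fun x => (chi R E x)%:C.

Lemma mem_dft_suppN (f : 'Z_n -> R) k :
  (- k \in dft_supp (fun x => (f x)%:C)) = (k \in dft_supp (fun x => (f x)%:C)).
Proof. by rewrite !inE -conj_dft // conjC_eq0. Qed.

Lemma dft_chi_0 E : dft (chiC E) 0 = #|E|%:R.
Proof.
rewrite dftE // -sum1_card natr_sum [in RHS]big_mkcond /=; apply: eq_bigr => j _.
rewrite mulr0 ech0 // mulr1 /chiC /chi.
by case: (j \in E); rewrite ?rmorph1 ?rmorph0.
Qed.

Lemma mem_dft_supp0 E : E != set0 -> 0 \in dft_supp (chiC E).
Proof. by move=> E0; rewrite inE dft_chi_0 pnatr_eq0 cards_eq0. Qed.

Lemma dft_supp_set0 : dft_supp (chiC set0) = set0.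
Proof.
apply/setP => k; rewrite !inE dftE // big1 ?eqxx // => j _.
by rewrite /chiC /chi inE rmorph0 mul0r.
Qed.

Lemma additive_on0 (A : {set 'Z_n}) (h : 'Z_n -> circle R) :
  additive_on A h -> 0 \in A -> h 0 = 0.
Proof. by move=> hA A0; apply: (addrI (h 0)); rewrite -hA ?addr0. Qed.

Lemma ech_cexp (k : 'Z_n) m :
  ech R k ^+ m = cexp (mod1 (- m%:R / n%:R * (k : nat)%:R)).
Proof.
rewrite cexp_mod1 -exprM zrootX // -mulrN; congr cis; congr (_ * _).
by rewrite natrM; ring.
Qed.

(** With [L * n = c] the phase [L k] is [c k / n]; as [ech] carries a minus sign, the shift is
    [- c]. *)
Lemma cexp_ech (L : R) (k : 'Z_n) : L * n%:R \is a Num.int ->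
  exists t : 'Z_n, forall k, cexp (mod1 (L * (k : nat)%:R)) = ech R (t * k).
Proof.
move=> /intrP[c e]; have nz : n%:R != 0 :> R by rewrite pnatr_eq0 -lt0n ltnW.
exists (- c%:~R) => l; rewrite -[L](mulfK nz) e.
have nat_case (m : nat) : cexp (mod1 (m%:R / n%:R * (l : nat)%:R)) = ech R (- (m%:R * l)).
  rewrite echN // [_ * l]mulrC ech_mulrn // ech_cexp -cexpN -mod1N.
  by congr (cexp (mod1 _)); ring.
case: c {e} => m; first by rewrite mulNr -nat_case.
rewrite NegzE !rmorphN opprK -[_ * l]opprK echN // -nat_case -cexpN -mod1N.
by congr (cexp (mod1 _)); rewrite !mulNr.
Qed.

Lemma deck3_of_extendable E g : E != set0 ->
  extendable_domain R (dft_supp (chiC E)) ->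
  (forall x1 x2, deck3 (chi R E) x1 x2 = deck3 g x1 x2) ->
  exists t, forall x, g x = chi R E (x - t).
Proof.
move=> E0 ext deck; pose F := chiC E; pose G x := (g x)%:C.
have FG k l : dft F k * dft F l * dft F (- k - l) = dft G k * dft G l * dft G (- k - l).
  by move: k l; apply/cdeck3_eqP => // x1 x2; rewrite !cdeck3_real deck.
have F0 : dft F 0 = (#|E|%:R)%:C by rewrite dft_chi_0 rmorph_nat.
have cE : #|E|%:R != 0 :> R by rewrite pnatr_eq0 cards_eq0.
move: (#|E|%:R : R) F0 cE => a F0 a0.
(* At [k = l = 0] the identity equates the cubes of two real numbers. *)
have FG0 : dft F 0 = dft G 0.
  have G0 : dft G 0 = (\sum_x g x)%:C.
    rewrite dftE // rmorph_sum; apply: eq_bigr => x _.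
    by rewrite mulr0 ech0 // mulr1.
  have := FG 0 0; rewrite oppr0 addr0 F0 G0 -!rmorphM => /complexI e.
  congr (_ %:C); apply/eqP; rewrite -subr_eq0.
  move: e; move: (\sum_x g x) => b e.
  have : (a - b) * (a ^+ 2 + a * b + b ^+ 2) = 0.
    by transitivity (a * a * a - b * b * b); [ring|rewrite e subrr].
  move/eqP; rewrite mulf_eq0 => /orP[//|/eqP h].
  have : 0 < a ^+ 2 by rewrite lt0r sqrf_eq0 a0 sqr_ge0.
  by nra.
have cF k : ((dft F k)^*)%R = dft F (- k) by exact: conj_dft.
have cG k : ((dft G k)^*)%R = dft G (- k) by exact: conj_dft.
(* Taking [l = 0] and cancelling the common nonzero value at 0 leaves the squared moduli. *)
have nF k : dft F k * (dft F k)^* = dft G k * (dft G k)^*.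
  have := FG k 0; rewrite subr0 -FG0 -cF -cG ![_ * dft F 0 * _]mulrAC => /mulIf; apply.
  by rewrite F0 fmorph_eq0.
have zF k : (dft F k == 0) = (dft G k == 0).
  rewrite -[dft F k == 0]orbb -{2}conjC_eq0 -mulf_eq0 nF mulf_eq0 conjC_eq0.
  by rewrite orbb.
have hex k : exists u, dft G k = dft F k * cexp u.
  have [F00|Fn] := eqVneq (dft F k) 0.
    by exists 0; move/eqP: F00 (F00); rewrite zF => /eqP -> ->; rewrite mul0r.
  by apply: cexp_ratio.
have [h hE] : exists h, forall k, dft G k = dft F k * cexp (h k).
  pose P k u := dft G k == dft F k * cexp u.
  have ex k : exists u, P k u by have [u /eqP] := hex k; exists u.
  by exists (fun k => xchoose (ex k)) => k; apply/eqP/(xchooseP (ex k)).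
have hadd : additive_on (dft_supp F) h.
  move=> k l; rewrite !inE => Fk Fl Fkl; apply: cexp_inj.
  have := FG k l; rewrite -opprD -cF -cG !hE rmorphM /= conj_cexp.
  set a' := dft F k; set b' := dft F l; set c' := (_^*)%R.
  have abc : a' * b' * c' != 0 by rewrite !mulf_neq0 // conjC_eq0.
  move=> e.
  have {e} : a' * b' * c' * 1 = a' * b' * c' * (cexp (h k) * cexp (h l) * cexp (- h (k + l))).
    by rewrite mulr1 [LHS]e; ring.
  move/(mulfI abc)/esym; rewrite cexpN cexpD.
  by move/(canRL (divfK (cexp_neq0 _))) => ->; rewrite mul1r.
have [L hL] := ext _ hadd.
(* A nonzero frequency [k] in the support makes [L * n] an integer, through [k] and [- k]. If 0 is
   the only frequency, [L] is unconstrained and the shift 0 serves. *)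
have [t tP] : exists t : 'Z_n, forall k, dft G k = dft F k * ech R (t * k).
  have [k /andP[Fk kn]|F1] := pickP (fun k => (dft F k != 0) && (k != 0)).
    have Fk' : - k \in dft_supp F by rewrite mem_dft_suppN inE.
    have Fk1 : k \in dft_supp F by rewrite inE.
    have A0 : 0 \in dft_supp F by exact: mem_dft_supp0.
    have : L * n%:R \is a Num.int.
      have : mod1 (L * (k : nat)%:R) + mod1 (L * ((- k) : nat)%:R) = 0.
        by rewrite -!hL // -hadd ?subrr // (additive_on0 hadd).
      rewrite -mod1D -mulrDr -natrD => /mod1_eq0; congr (L * _%:R \is a _).
      by rewrite addn_oppZ.
    case/cexp_ech => // t tP; exists t => l.
    have [F00|Fn] := eqVneq (dft F l) 0.
      by move/eqP: F00 (F00); rewrite zF => /eqP -> ->; rewrite mul0r.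
    by rewrite hE hL ?inE // tP.
  exists 0 => l; rewrite mul0r ech0 // mulr1.
  have [->|ln] := eqVneq l 0; first by symmetry; exact: FG0.
  have := F1 l; rewrite ln andbT => /negbFE/eqP F00.
  by move/eqP: F00 (F00); rewrite zF => /eqP -> ->.
exists t => x; apply: complexI.
suff : G =1 fun x => F (x - t) by apply.
by apply: dft_inj => // k; rewrite dft_shift // mulNr opprK tP.
Qed.

Lemma extendable_of_deck3 E : E != set0 ->
  (forall g, (forall x1 x2, deck3 (chi R E) x1 x2 = deck3 g x1 x2) ->
     exists t, forall x, g x = chi R E (x - t)) ->
  extendable_domain R (dft_supp (chiC E)).
Proof.
move=> E0 rec h hadd; pose F := chiC E.
have A0 : 0 \in dft_supp F by exact: mem_dft_supp0.
have h0 := additive_on0 hadd A0.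
have hN k : k \in dft_supp F -> h (- k) = - h k.
  move=> Fk; apply: (addrI (h k)); rewrite -hadd ?subrr ?mem_dft_suppN //.
have cF k : ((dft F k)^*)%R = dft F (- k) by exact: conj_dft.
(* The function [g] keeps the moduli of the spectrum of [F] and turns its phases by [h]; it is real
   because [h] is odd on the support. *)
pose Gh k := dft F k * cexp (h k); pose G := idft Gh.
pose g x := complex.Re (G x).
have Gg x : G x = (g x)%:C.
  have : ((G x)^*)%R = G x.
    rewrite /G /idft rmorphM fmorphV rmorph_nat rmorph_sum; congr (_ * _).
    rewrite (reindex_inj oppr_inj); apply: eq_bigr => k _ /=.
    rewrite rmorphM /= conj_ech // mulNr opprK /Gh rmorphM /= conj_cexp cF opprK.
    have [F00|Fk] := eqVneq (dft F k) 0; first by rewrite F00 !mul0r.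
    by rewrite hN ?inE // opprK.
  rewrite /g; case: (G x) => a b [] e; apply/eqP; rewrite eq_complex /= eqxx /=.
  by apply/eqP; lra.
have dG k : dft (fun x => (g x)%:C) k = Gh k.
  by rewrite -(idftK n_gt1 Gh); apply: eq_bigr => x _; rewrite -Gg.
have [|t tP] := rec g.
  move=> x1 x2; apply: complexI; rewrite -!cdeck3_real.
  move: x1 x2; apply/cdeck3_eqP => // k l; rewrite !dG /Gh -/F.
  have [Fk|Fk] := eqVneq (dft F k) 0; first by rewrite [dft F k]Fk !mul0r.
  have [Fl|Fl] := eqVneq (dft F l) 0; first by rewrite [dft F l]Fl !(mul0r, mulr0).
  rewrite -opprD.
  have [Fm|Fm] := eqVneq (dft F (- (k + l))) 0; first by rewrite Fm !(mul0r, mulr0).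
  have Fkl : k + l \in dft_supp F by rewrite -mem_dft_suppN inE.
  have hkl : h (k + l) = h k + h l by apply: hadd; rewrite // inE.
  rewrite hN // hkl cexpN cexpD -/F.
  have := cexp_neq0 (h k); have := cexp_neq0 (h l).
  by move: (cexp _) (cexp _) => u v u0 v0; field; rewrite u0 v0.
(* The shift by [t] multiplies the transform by [ech (t * k)], whose phase is [- t k / n]. *)
exists (- (t : nat)%:R / n%:R) => k Fk; apply: cexp_inj.
rewrite -ech_cexp -ech_mulrn // natr_Zp.
have Fk0 : dft F k != 0 by move: Fk; rewrite inE.
apply: (mulfI Fk0); rewrite -/(Gh k) -dG -[k * t]opprK -mulrN (mulrC k) -dft_shift //.
by apply: eq_bigr => x _; rewrite tP.
Qed.

End DeckExtendable.

(** * Supports that are not extendable *)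

Lemma sum_geom (F : fieldType) (z : F) m :
  z != 1 -> \sum_(i < m) z ^+ i = (z ^+ m - 1) / (z - 1).
Proof. by move=> z1; rewrite subrX1 mulrAC mulfV ?mul1r // subr_eq0. Qed.

Lemma sum_unity (F : fieldType) (z : F) m :
  z ^+ m = 1 -> \sum_(i < m) z ^+ i = m%:R *+ (z == 1).
Proof.
move=> zm; have [->|z1] := eqVneq z 1; last by rewrite sum_geom // zm subrr mul0r.
by under eq_bigr do rewrite expr1n; rewrite sumr_const card_ord.
Qed.

Section NonExtendable.
Variables (R : realType) (n : nat).
Hypothesis n_gt1 : (1 < n)%N.
Implicit Types (x y k l : 'Z_n) (E : {set 'Z_n}).

Let chiC E : 'Z_n -> R[i] := fun x => (chi R E x)%:C.

Lemma dft_chiE E k : dft (chiC E) k = \sum_(x in E) ech R (x * k).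
Proof.
rewrite dftE // [RHS]big_mkcond; apply: eq_bigr => j _; rewrite /chiC /chi.
by case: (j \in E); rewrite ?rmorph1 ?rmorph0 ?mul1r ?mul0r.
Qed.

Lemma zroot_eq1 m : (zroot R n ^+ m == 1) = (n %| m)%N.
Proof. by rewrite -(prim_order_dvd (zroot_prim R n_gt1)). Qed.

Lemma ech_natM m k : ech R (m%:R * k) = zroot R n ^+ (m * k).
Proof. by rewrite mulrC ech_mulrn // -exprM mulnC. Qed.

Lemma dvdZD d x y : (d %| n)%N -> (d %| ((x + y)%R : nat))%N = (d %| x + y)%N.
Proof. by move=> dn; rewrite val_addZ // /dvdn modn_dvdm. Qed.

Lemma even_not_extendable : (2 < n)%N -> ~~ odd n ->
  exists E, ~ extendable_domain R (dft_supp (chiC E)).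
Proof.
move=> n2 evn; pose m := n./2.
have nm : n = (m * 2)%N by rewrite muln2 /m -[in LHS](odd_double_half n) (negPf evn).
pose E := [set x : 'Z_n | (x < m)%N]; exists E => ext.
have FE k : dft (chiC E) k = \sum_(i < m) ech R k ^+ i.
  rewrite dft_chiE (big_ord_widen (Zp_trunc n).+2 (fun i => ech R k ^+ i)).
    apply: eq_big => [x|x _]; first by rewrite inE.
    by rewrite -{1}[x]natr_Zp mulrC ech_mulrn.
  by rewrite (Zp_cast n_gt1) nm leq_pmulr.
have Fodd k : odd k -> k \in dft_supp (chiC E).
  move=> ok; have e1 : ech R k != 1.
    by apply/eqP => /ech_eq1 k0; rewrite k0 // in ok.
  rewrite inE FE sum_geom // mulf_neq0 ?invr_eq0 ?subr_eq0 // -exprM zroot_eq1.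
  rewrite [X in (X %| _)%N]nm (mulnC k) dvdn_pmul2l ?dvdn2 ?ok //.
  by rewrite -(ltn_pmul2r (isT : (0 < 2)%N)) -nm ltnW // ltnW.
have Feven k : k \in dft_supp (chiC E) -> k != 0 -> odd k.
  rewrite inE FE => h k0; apply: contraNT h => ek; rewrite sum_unity.
    suff /negPf -> : ech R k != 1 by [].
    by apply: contra k0 => /eqP /ech_eq1 ->.
  apply/eqP; rewrite -exprM zroot_eq1 [X in (X %| _)%N]nm.
  by rewrite mulnC dvdn_mul // dvdn2.
have nR : n%:R != 0 :> R by rewrite pnatr_eq0 -lt0n ltnW.
have n2R : n%:R - 2 != 0 :> R by rewrite subr_eq0 eqr_nat gtn_eqF.
(* The constant makes n h(1) = 1/2, whereas a linear h has n h(1) = 0. *)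
pose c : R := (2 * n%:R * (n%:R - 2))^-1.
pose h k := if k == 0 then 0 else mod1 (c * (2 * (k : nat)%:R - n%:R)).
have hN k : h (- k) = - h k.
  rewrite /h oppr_eq0; have [_|k0] := eqVneq k 0; first by rewrite oppr0.
  have e : n%:R = (k : nat)%:R + ((- k)%R : nat)%:R :> R by rewrite -natrD addn_oppZ.
  by rewrite -mod1N e; congr mod1; ring.
have h0 : h 0 = 0 by rewrite /h eqxx.
have hadd : additive_on (dft_supp (chiC E)) h.
  move=> x y; have [->|x0] := eqVneq x 0; first by rewrite h0 !add0r.
  have [->|y0] := eqVneq y 0; first by rewrite h0 !addr0.
  move=> /Feven/(_ x0) ox /Feven/(_ y0) oy /Feven oxy.
  (* Two odd frequencies have an even sum, also after reduction modulo the even [n], and 0 is the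
     only even frequency in the support. *)
  have xy0 : x + y = 0.
    apply/eqP; apply: contraTT isT => /oxy.
    by rewrite -[odd _]negbK -dvdn2 dvdZD ?dvdn2 ?oddD ?ox ?oy.
  by rewrite xy0 h0 (_ : y = - x) ?hN ?subrr //; apply: (addrI x); rewrite subrr.
have [L hL] := ext h hadd.
have one0 : (1 : 'Z_n) != 0 by exact: oner_neq0.
have v1 : (1 : 'Z_n) = 1%N :> nat by have := val_natZ n_gt1 1; rewrite modn_small.
have o1 : odd (1%R : 'Z_n) by rewrite v1.
have oN1 : odd ((- 1)%R : 'Z_n).
  have /(congr1 odd) := addn_oppZ n_gt1 one0; rewrite v1 /= (negPf evn).
  by move/negbFE.
have := hL _ (Fodd _ o1); have := hL _ (Fodd _ oN1).
rewrite hN => e1 e2.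
have : mod1 (L * n%:R) = 0.
  rewrite -(addn_oppZ n_gt1 one0) natrD mulrDr mod1D.
  by rewrite -e1 -e2 subrr.
move: e2; rewrite /h (negPf one0) v1 mod1_eq mulr1 => /intrP[z ez] /mod1_eq0/intrP[z' ez'].
(* Indeed [z' + z n = n c (2 - n) = - 1 / 2], impossible for integers. *)
have : (2 * (z' + z * n%:Z) = -1 :> int)%R.
  apply: (@intr_inj R); rewrite intrM intrD intrM -ez' -ez /c -pmulrn.
  rewrite (_ : (-1)%:~R = -1 :> R) //.
  by field; rewrite nR n2R.
by lia.
Qed.

Lemma four_factors_not_extendable (p p' q l : nat) :
  n = (p * p' * q * l)%N -> coprime p q -> (1 < p)%N -> (1 < q)%N -> (1 < l)%N ->
  ~~ (p' %| q)%N ->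
  exists E, ~ extendable_domain R (dft_supp (chiC E)).
Proof.
move=> nE copq p1 q1 l1 np'q.
have p'0 : (0 < p')%N by rewrite lt0n; apply: contraTneq n_gt1 => p'0; rewrite nE p'0 muln0.
have p0 := ltnW p1; have q0 := ltnW q1; have l0 := ltnW l1.
(* Since [p * p' * l = n / q] and [p' * q * l = n / p], the branches are the subgroup of order [q]
   and the subgroup of order [p] moved by 1. *)
pose psi (b : 'I_q + 'I_p) : nat :=
  match b with inl y => y * (p * p' * l) | inr y => 1 + y * (p' * q * l) end%N.
pose phi (a : 'I_p' * ('I_q + 'I_p)) : nat := (a.1 * l + psi a.2)%N.
have phi_lt a : (phi a < n)%N.
  case: a => i [y|y]; rewrite /phi /= nE; have ip := ltn_ord i; have yq := ltn_ord y.
    have h1 : (i * l < p' * l)%N by rewrite ltn_pmul2r // ltnW.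
    have h2 : (p' * l <= p * (p' * l))%N by rewrite leq_pmull // ltnW.
    have h3 : (y.+1 * (p * p' * l) <= q * (p * p' * l))%N by rewrite leq_mul2r yq orbT.
    by move: h1 h2 h3; rewrite mulSn; lia.
  have h1 : (i.+1 * l <= p' * l)%N by rewrite leq_mul2r ip orbT.
  have h2 : (p' * l <= q * (p' * l))%N by rewrite leq_pmull // ltnW.
  have h3 : (y.+1 * (p' * q * l) <= p * (p' * q * l))%N by rewrite leq_mul2r yq orbT.
  by move: h1 h2 h3; rewrite !mulSn; lia.
(* As [l > 1], the residue modulo [l] tells the branches apart; after division by [l], the residue
   modulo [p'] recovers [i]. *)
have phi_inj : injective phi.
  have mod_l (i : nat) b : ((i * l + psi b) %% l)%N = (if b is inl _ then 0 else 1)%N.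
    case: b => y /=; first by rewrite modnMDl mulnA modnMl.
    by rewrite modnMDl mulnA addnC modnMDl modn_small.
  move=> [i b] [j d]; rewrite /phi /= => e.
  have := mod_l i b; rewrite e mod_l.
  case: b d e => [y|y] [u|u] //= e _.
    have {}e : (y * p * p' + i = u * p * p' + j)%N by nia.
    have ij : i = j.
      by apply: val_inj; have := congr1 (modn ^~ p') e; rewrite /= !modnMDl !modn_small.
    by rewrite ij; congr (_, inl _); apply: val_inj; apply/eqP => /=;
      move/eqP: e; rewrite ij eqn_add2r -!mulnA eqn_pmul2r // muln_gt0 p'0 ltnW.
  have {}e : (y * q * p' + i = u * q * p' + j)%N by nia.
  have ij : i = j.
    by apply: val_inj; have := congr1 (modn ^~ p') e; rewrite /= !modnMDl !modn_small.
  by rewrite ij; congr (_, inr _); apply: val_inj; apply/eqP => /=;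
      move/eqP: e; rewrite ij eqn_add2r -!mulnA eqn_pmul2r // muln_gt0 p'0 ltnW.
pose E := [set ((phi a)%:R : 'Z_n) | a in setT]; exists E => ext.
pose w := zroot R n.
pose G k := \sum_(i < p') (w ^+ (l * k)) ^+ i.
have FE k : dft (chiC E) k = G k * (q%:R *+ (q %| k)%N + w ^+ k * (p%:R *+ (p %| k)%N)).
  rewrite dft_chiE big_imset /=; last first.
    move=> a b _ _ /(congr1 (fun x : 'Z_n => (x : nat))).
    by rewrite !val_natZ // !modn_small // => /phi_inj.
  have -> : q%:R *+ (q %| k)%N = \sum_(y < q) (w ^+ (p * p' * l * k)) ^+ y.
    rewrite sum_unity -?exprM.
      congr (_ *+ nat_of_bool _); rewrite zroot_eq1 [X in _ = (X %| _)%N]nE.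
      rewrite (_ : p * p' * q * l = p * p' * l * q)%N; last by ring.
      by rewrite dvdn_pmul2l // !muln_gt0 p0 p'0.
    by apply/eqP; rewrite zroot_eq1 [X in (X %| _)%N]nE; apply/dvdnP; exists k; ring.
  have -> : p%:R *+ (p %| k)%N = \sum_(y < p) (w ^+ (p' * q * l * k)) ^+ y.
    rewrite sum_unity -?exprM.
      congr (_ *+ nat_of_bool _); rewrite zroot_eq1 [X in _ = (X %| _)%N]nE.
      rewrite (_ : p * p' * q * l = p' * q * l * p)%N; last by ring.
      by rewrite dvdn_pmul2l // !muln_gt0 p'0 q0.
    by apply/eqP; rewrite zroot_eq1 [X in (X %| _)%N]nE; apply/dvdnP; exists k; ring.
  have -> : \sum_(y < q) (w ^+ (p * p' * l * k)) ^+ y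
      + w ^+ k * \sum_(y < p) (w ^+ (p' * q * l * k)) ^+ y = \sum_b w ^+ (psi b * k).
    rewrite big_sumType /=; congr (_ + _).
      by apply: eq_bigr => y _; rewrite -exprM; congr (_ ^+ _); ring.
    rewrite mulr_sumr; apply: eq_bigr => y _; rewrite -exprM -exprD; congr (_ ^+ _); ring.
  rewrite mulr_suml; under [RHS]eq_bigr do rewrite mulr_sumr.
  rewrite pair_bigA /= (eq_bigl predT) => [|a]; last by rewrite inE.
  apply: eq_bigr => a _; rewrite ech_natM -exprM -exprD; congr (_ ^+ _); rewrite /phi; ring.
(* When [p * q] divides [k], the factor [G k] sums the first [p'] powers of a [p']-th root of unity,
   so it vanishes unless that root is 1. *)
have supp k : k \in dft_supp (chiC E) ->
    (((q %| k) || (p %| k)) && ((p * q %| k) ==> (p * p' * q %| k)))%N.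
  rewrite inE FE mulf_eq0 negb_or => /andP[Gk Fk]; apply/andP; split.
    apply: contraNT Fk; rewrite negb_or => /andP[/negPf -> /negPf ->].
    by rewrite !mulr0n mulr0 addr0.
  apply/implyP => pqk; apply: contraNT Gk => npq; apply/eqP; rewrite /G sum_unity.
    rewrite zroot_eq1 [X in (X %| _)%N]nE (mulnC l) dvdn_pmul2r ?(negPf npq) //; exact: ltnW.
  apply/eqP; rewrite -exprM zroot_eq1 [X in (X %| _)%N]nE.
  by case/dvdnP: pqk => c ->; apply/dvdnP; exists c; ring.
have Gn0 k : ~~ (n %| l * k * p')%N -> G k != 0.
  move=> nk; rewrite /G sum_geom; last first.
    by apply: contra nk; rewrite zroot_eq1 => h; apply: dvdn_mulr.
  rewrite mulf_neq0 ?invr_eq0 ?subr_eq0 -?exprM ?zroot_eq1 //.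
  by apply: contra nk => h; apply: dvdn_mulr.
have npq : ~~ (p %| q)%N.
  by apply/negP => /gcdn_idPl e; move: copq; rewrite /coprime e => /eqP e1; rewrite e1 in p1.
have nqp : ~~ (q %| p)%N.
  by apply/negP => /gcdn_idPr e; move: copq; rewrite /coprime e => /eqP e1; rewrite e1 in q1.
have qn : (q < n)%N.
  rewrite nE (_ : p * p' * q * l = q * (p * (p' * l)))%N; last by ring.
  by rewrite ltn_Pmulr // (leq_trans p1) // leq_pmulr // muln_gt0 p'0.
have pn : (p < n)%N.
  rewrite nE (_ : p * p' * q * l = p * (q * (p' * l)))%N; last by ring.
  by rewrite ltn_Pmulr // (leq_trans q1) // leq_pmulr // muln_gt0 p'0.
have vq : (q%:R : 'Z_n) = q :> nat by rewrite val_natZ // modn_small.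
have vp : (p%:R : 'Z_n) = p :> nat by rewrite val_natZ // modn_small.
have natC0 m : (0 < m)%N -> m%:R != 0 :> R[i] by rewrite pnatr_eq0 -lt0n.
have Aq : q%:R \in dft_supp (chiC E).
  rewrite inE FE vq dvdnn (negPf npq) mulr0n mulr0 addr0 mulf_neq0 ?natC0 // Gn0 // vq.
  rewrite [X in (X %| _)%N]nE (_ : l * q * p' = q * l * p' * 1)%N; last by ring.
  rewrite (_ : p * p' * q * l = q * l * p' * p)%N; last by ring.
  by rewrite dvdn_pmul2l ?dvdn1 ?muln_gt0 ?p'0 ?q0 ?l0 // gtn_eqF.
have Ap : p%:R \in dft_supp (chiC E).
  rewrite inE FE vp dvdnn (negPf nqp) mulr0n add0r.
  rewrite !mulf_neq0 ?natC0 ?expf_neq0 ?zroot_neq0 // Gn0 // vp.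
  rewrite [X in (X %| _)%N]nE (_ : l * p * p' = p * l * p' * 1)%N; last by ring.
  rewrite (_ : p * p' * q * l = p * l * p' * q)%N; last by ring.
  by rewrite dvdn_pmul2l ?dvdn1 ?muln_gt0 ?p'0 ?p0 ?l0 // gtn_eqF.
pose N := (p * p')%N.
have N0 : N%:R != 0 :> R by rewrite pnatr_eq0 muln_eq0 negb_or -!lt0n p0 p'0.
pose kap k : circle R := mod1 ((k : nat)%:R / N%:R).
have kap0 (k : 'Z_n) : (N %| k)%N -> kap k = 0.
  by case/dvdnP => c e; apply/mod1_eq0; rewrite e natrM mulfK // rpred_nat.
have kapD x y : kap (x + y) = kap x + kap y.
  rewrite /kap -mod1D -mulrDl -natrD val_addZ // [in RHS](divn_eq (x + y) n).
  rewrite natrD mulrDl mod1D [X in _ = X + _](_ : _ = 0) ?add0r //.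
  have nN : n%:R = N%:R * (q * l)%:R :> R by rewrite -natrM mulnA -nE.
  by apply/mod1_eq0; rewrite natrM nN mulrCA (mulrC N%:R) mulfK // -natrM rpred_nat.
pose h k := if ((q %| k) && ~~ (p %| k))%N then kap k else 0.
have dn_p : (p %| n)%N by rewrite nE -!mulnA dvdn_mulr.
have dn_q : (q %| n)%N by rewrite nE dvdn_mulr // dvdn_mull.
(* Frequencies divisible by both [p] and [q] have [kap] equal to 0. If one summand is divisible only
   by [p] and the other only by [q], the sum is divisible by neither and lies outside the
   support. *)
have hadd : additive_on (dft_supp (chiC E)) h.
  move=> x y /supp/andP[x1 /implyP x2] /supp/andP[y1 /implyP y2] /supp/andP[s1 /implyP s2].
  have both_dvd (k : 'Z_n) : ((p * q %| k) -> (p * p' * q %| k))%N ->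
      (q %| k)%N -> (p %| k)%N -> kap k = 0.
    move=> hk qk pk; apply: kap0; apply: (@dvdn_trans (p * p' * q)); first exact: dvdn_mulr.
    by apply: hk; rewrite Gauss_dvd // pk.
  rewrite /h; move: s1; rewrite !(dvdZD _ _ dn_p) !(dvdZD _ _ dn_q).
  have [qx|qx] := boolP (q %| x)%N.
    have [px|px] := boolP (p %| x)%N.
      rewrite add0r /= (dvdn_addr _ qx) (dvdn_addr _ px).
      by case: ifP => // _ _; rewrite kapD (both_dvd x) ?add0r.
    rewrite (dvdn_addr _ qx) /=.
    have [qy|qy] := boolP (q %| y)%N.
      have [py|py] := boolP (p %| y)%N.
        by rewrite (dvdn_addl _ py) px /= kapD (both_dvd y).
      have [pxy|pxy] /= := boolP (p %| x + y)%N; last by rewrite kapD.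
      rewrite -kapD (both_dvd (x + y)) // (dvdZD _ _ dn_p, dvdZD _ _ dn_q) //.
      by rewrite dvdn_add.
    move: y1; rewrite (negPf qy) /= => py.
    by rewrite (dvdn_addl _ py) (negPf px).
  move: x1; rewrite (negPf qx) /= => px.
  have [qy|qy] := boolP (q %| y)%N.
    rewrite (dvdn_addl _ qy) (negPf qx) (dvdn_addr _ px) /= => py.
    by rewrite py addr0.
  move: y1; rewrite (negPf qy) /= => py.
  by rewrite (dvdn_add px py) andbF addr0.
have [L hL] := ext h hadd.
have := hL _ Aq; have := hL _ Ap.
rewrite /h vp vq !dvdnn npq (negPf nqp) /= /kap vq => /esym/mod1_eq0/intrP[c ec].
rewrite mod1_eq => /intrP[d ed].
(* From [h p = 0] comes [L p = c], from [h q = q / (p p')] comes [q / (p p') - L q = d]; clearing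
   denominators makes [q] a multiple of [p']. *)
have : (q%:Z - c * q%:Z * p'%:Z = d * (p * p')%:Z)%R.
  apply: (@intr_inj R); rewrite !rmorphB !rmorphM /= -!pmulrn -ed -ec /N natrM.
  have p0R : p%:R != 0 :> R by rewrite pnatr_eq0 -lt0n.
  have p'0R : p'%:R != 0 :> R by rewrite pnatr_eq0 -lt0n.
  by field; rewrite p0R p'0R.
move=> e; case/negP: np'q.
have : (p'%:Z %| q%:Z)%Z.
  have -> : q%:Z = (c * q%:Z + d * p%:Z) * p'%:Z by rewrite PoszM in e; nia.
  exact: dvdz_mull.
by [].
Qed.

End NonExtendable.

(** * Vanishing of the Fourier transform of a set *)

(** [X^d - 1] is the product of the ['Phi_c] over [c] dividing [d]; if [z] is a root of the factor
    for [c], then [z ^ c = 1], so [d] divides [c]. *)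
Lemma root_Cyclotomic (F : numFieldType) d (z : F) :
  d.-primitive_root z -> root (map_poly intr 'Phi_d) z.
Proof.
move=> pz; have d0 := prim_order_gt0 pz.
have prodE e : (0 < e)%N ->
    \prod_(c <- divisors e) map_poly intr 'Phi_c = 'X^e - 1 :> {poly F}.
  move=> e0; rewrite -rmorph_prod /= prod_Cyclotomic //.
  by rewrite rmorphB /= map_polyXn rmorph1.
have : root (\prod_(c <- divisors d) map_poly intr 'Phi_c) z.
  by rewrite prodE // /root !hornerE (prim_expr_order pz) subrr.
rewrite rootE horner_prod prodf_seq_eq0 => /hasP[c cd /= rc].
have cd' : (c %| d)%N by rewrite dvdn_divisors.
have c0 : (0 < c)%N by apply: dvdn_gt0 d0 cd'.
suff /eqP <- : c == d by [].
rewrite eqn_dvd cd' (prim_order_dvd pz) -subr_eq0.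
have : root ('X^c - 1) z.
  rewrite -prodE // rootE horner_prod prodf_seq_eq0; apply/hasP; exists c => //.
  by rewrite -dvdn_divisors.
by rewrite /root !hornerE.
Qed.

(** The detour through [algC] gives access to ['Phi_d] as a minimal polynomial. The gcd of [P] and
    ['Phi_d] over the rationals has the root [z] in [F], so it is not constant and has a root in
    [algC]; there minimality makes ['Phi_d] divide [P]. *)
Lemma primitive_root_conj (F : numFieldType) d (z z' : F) (P : {poly rat}) :
  d.-primitive_root z -> d.-primitive_root z' ->
  root (map_poly ratr P) z -> root (map_poly ratr P) z'.
Proof.
move=> pz pz' Pz; pose Phi : {poly rat} := map_poly intr 'Phi_d.
have ratPhi (K : numFieldType) : map_poly ratr Phi = map_poly intr 'Phi_d :> {poly K}.
  by rewrite -map_poly_comp; apply: eq_map_poly => c; rewrite /= ratr_int.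
have Phi0 : Phi != 0 by apply/monic_neq0/monic_map/Cyclotomic_monic.
pose Q := gcdp P Phi.
have Q0 : Q != 0 by rewrite gcdp_eq0 negb_and Phi0 orbT.
have Qz : root (map_poly ratr Q) z.
  by rewrite gcdp_map root_gcd Pz ratPhi root_Cyclotomic.
have sQ : size Q != 1%N.
  rewrite -(size_map_poly (ratr : {rmorphism rat -> F})) gtn_eqF //.
  by apply: root_size_gt1 Qz; rewrite map_poly_eq0.
have /closed_rootP[xi Qxi] : size (map_poly ratr Q : {poly algC}) != 1%N.
  by rewrite size_map_poly.
move: Qxi; rewrite gcdp_map root_gcd ratPhi => /andP[Pxi Phixi].
have d0 := prim_order_gt0 pz; have [z0 pz0] := C_prim_root_exists d0.
have pxi : d.-primitive_root xi.
  by rewrite -(root_cyclotomic pz0) -(Cintr_Cyclotomic pz0).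
have [p [minE _] minP] := minCpolyP xi.
have pE : p = Phi.
  apply: (map_poly_inj (ratr : {rmorphism rat -> algC})).
  by rewrite -minE (minCpoly_cyclotomic pxi) -(Cintr_Cyclotomic pxi) ratPhi.
move: Pxi; rewrite minP pE => /dvdpP[T ->].
by rewrite rmorphM /= rootM ratPhi root_Cyclotomic // orbT.
Qed.

Section Vanishing.
Variables (R : realType) (n : nat).
Hypothesis n_gt1 : (1 < n)%N.
Implicit Types (x y k l : 'Z_n) (E : {set 'Z_n}).

Let chiC E : 'Z_n -> R[i] := fun x => (chi R E x)%:C.

(** The transform at [k] is the value of a rational polynomial at [zroot ^ k], a root of unity whose
    order depends only on [gcdn k n]. *)
Lemma dft_chi_gcd E k l :
  gcdn k n = gcdn l n -> dft (chiC E) k = 0 -> dft (chiC E) l = 0.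
Proof.
move=> kl; pose P : {poly rat} := \sum_(x in E) 'X^x.
have FE k' : dft (chiC E) k' = (map_poly ratr P).[zroot R n ^+ k'].
  rewrite dft_chiE // rmorph_sum horner_sum; apply: eq_bigr => x _ /=.
  by rewrite map_polyXn hornerXn mulrC -{1}[x]natr_Zp ech_mulrn.
have prim k' := exp_prim_root (zroot_prim R n_gt1) k'.
rewrite !FE => /rootP h; apply/rootP.
by apply: (primitive_root_conj (prim k)); rewrite // kl; exact: prim.
Qed.

(** Shifting by [n / q] multiplies the transform at [k] by a character value that is 1 only if [q]
    divides [k]. *)
Lemma dft_periodic (f : 'Z_n -> R[i]) q : (q %| n)%N -> 
  (forall x, f (x + (n %/ q)%:R) = f x) ->
  forall k, ~~ (q %| k)%N -> dft f k = 0.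
Proof.
move=> qn fq k qk; have := dft_shift n_gt1 f (n %/ q)%:R k.
rewrite (_ : dft _ k = dft f k); last by apply: eq_bigr => x _; rewrite fq.
move/eqP; rewrite -subr_eq0 -{1}[dft f k]mulr1 -mulrBr mulf_eq0 => /orP[/eqP //|].
rewrite subr_eq0 eq_sym => /eqP/ech_eq1 => /(_ n_gt1)/eqP; rewrite oppr_eq0 => /eqP e.
case/negP: qk; have := congr1 (@ech R n) e; rewrite ech0 // ech_natM // => /eqP.
rewrite zroot_eq1 //.
have n0 : (0 < n)%N by exact: ltnW.
have q0 : (0 < q)%N := dvdn_gt0 n0 qn.
rewrite -{1}(divnK qn) dvdn_pmul2l // divn_gt0 // dvdn_leq //.
Qed.

Lemma natZ_n : n%:R = 0 :> 'Z_n.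
Proof. by apply: val_inj; rewrite /= val_natZ // modnn. Qed.

Lemma ech_div q k i : (q %| n)%N -> (q %| k)%N -> ech R ((n %/ q * i)%:R * k) = 1.
Proof.
move=> qn /dvdnP[c e]; rewrite ech_natM //; apply/eqP; rewrite zroot_eq1 //.
by rewrite e -{1}(divnK qn); apply/dvdnP; exists (i * c)%N; ring.
Qed.

(** If [E] is invariant under neither the subgroup of order [q] nor that of order [r], then in one
    coset of their sum it is a union of cosets of the latter, and in another one a union of cosets
    of the former; comparing numbers of points contradicts [coprime q r]. *)
Lemma chi_coset_dichotomy E q r :
  coprime q r -> (q * r %| n)%N ->
  (forall k, ~~ (q %| k)%N -> ~~ (r %| k)%N -> dft (chiC E) k = 0) ->
  (forall k, (q %| k)%N -> (r %| k)%N -> k != 0 -> dft (chiC E) k = 0) ->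
  (forall k, ~~ (q %| k)%N -> dft (chiC E) k = 0) \/
  (forall k, ~~ (r %| k)%N -> dft (chiC E) k = 0).
Proof.
move=> cqr qrn H1 H2; set F := chiC E.
have n0 : (0 < n)%N by exact: ltnW.
have qn : (q %| n)%N := dvdn_trans (dvdn_mulr _ (dvdnn q)) qrn.
have rn : (r %| n)%N := dvdn_trans (dvdn_mull _ (dvdnn r)) qrn.
have q0 := dvdn_gt0 n0 qn; have r0 := dvdn_gt0 n0 rn.
pose a (i : nat) : 'Z_n := (n %/ q * i)%:R; pose b (j : nat) : 'Z_n := (n %/ r * j)%:R.
pose f x : nat := x \in E.
have Ff x : F x = (f x)%:R by rewrite /F /chiC /chi rmorph_nat.
(* The mixed second difference has as transform [dft F k] times two factors, one zero for [q %| k]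
   and the other for [r %| k]; [H1] covers the remaining [k]. *)
have sq x i j : (f (x + (a i + b j))%R + f x = f (x + a i)%R + f (x + b j)%R)%N.
  pose G x := (F (x + (a i + b j)) - F (x + a i)) - (F (x + b j) - F x).
  have G0 : forall x, G x = 0.
    apply: dft_eq0 => // k; rewrite !dftB // !dft_shift // mulrDl opprD echD //.
    transitivity (dft F k * (ech R (- (a i * k)) - 1) * (ech R (- (b j * k)) - 1)).
      by ring.
    rewrite !echN //.
    have [qk|qk] := boolP (q %| k)%N; first by rewrite ech_div // invr1 subrr mulr0 mul0r.
    have [rk|rk] := boolP (r %| k)%N; first by rewrite (ech_div _ rn) // invr1 subrr mulr0.
    by rewrite H1 // !mul0r.
  apply/eqP; rewrite -(eqr_nat R[i]) !natrD -!Ff -subr_eq0; apply/eqP.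
  by rewrite -(G0 x) /G; ring.
pose s x := (\sum_(i < q) \sum_(j < r) f (x + (a i + b j))%R)%N.
(* [s x] counts the points of [E] in the coset of [x]. Its transform is [dft F k] times a character
   sum over each subgroup; these sums vanish unless [q] and [r] divide [k], and then [H2] applies if
   [k] is not 0. *)
have s_const x y : s x = s y.
  pose S x := \sum_(i < q) \sum_(j < r) F (x + (a i + b j)).
  have SE z : S z = (s z)%:R.
    rewrite natr_sum; apply: eq_bigr => i _; rewrite natr_sum; apply: eq_bigr => j _.
    by rewrite Ff.
  have vanish c k : (c %| n)%N -> ~~ (c %| k)%N ->
      \sum_(i < c) ech R (- ((n %/ c * i)%:R * k)) = 0.
    move=> cn ck; have c0 := dvdn_gt0 n0 cn.
    under eq_bigr do rewrite natrM mulrAC -mulNr ech_mulrn //.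
    rewrite sum_unity; last first.
      rewrite -ech_mulrn // mulNr echN // mulrAC -natrM (divnK cn) ech_natM //.
      by apply/eqP; rewrite invr_eq1 zroot_eq1 // dvdn_mulr.
    case: eqVneq => // /ech_eq1 => /(_ n_gt1)/eqP; rewrite oppr_eq0 => /eqP e.
    case/negP: ck; have := congr1 (@ech R n) e; rewrite ech0 // ech_natM // => /eqP.
    rewrite zroot_eq1 // -{1}(divnK cn) dvdn_pmul2l // divn_gt0 // dvdn_leq //.
  have dS k : k != 0 -> dft S k = 0.
    move=> k0; rewrite dft_sum //; under eq_bigr do rewrite dft_sum //.
    under eq_bigr => i _.
      under eq_bigr do rewrite dft_shift // mulrDl opprD echD // mulrA.
      rewrite -mulr_sumr; over.
    rewrite -mulr_suml -mulr_sumr.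
    have [qk|qk] := boolP (q %| k)%N; last by rewrite vanish // mulr0 mul0r.
    have [rk|rk] := boolP (r %| k)%N; last by rewrite (vanish r) // mulr0.
    by rewrite H2 // !mul0r.
  have : (fun z => S (z + (y - x))) =1 S.
    apply: dft_inj => // k; rewrite dft_shift //.
    have [->|k0] := eqVneq k 0; first by rewrite mulr0 oppr0 ech0 // mulr1.
    by rewrite dS // mul0r.
  move/(_ x); rewrite addrC subrK => /esym/eqP; rewrite !SE eqr_nat => /eqP.
  by [].
have [/existsP[x /existsP[i xi]]|/existsPn inv] :=
    boolP [exists x, exists i : 'I_q, f (x + a i) != f x]; last first.
  left=> k qk; apply: (dft_periodic qn) qk => x.
  (* The index 1 exists in ['I_q] only for [q > 1]; for [q = 1] the shift is by [n], that is 0. *)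
  have [q1|q1] := leqP q 1.
    have -> : q = 1%N by apply/eqP; rewrite eqn_leq q1.
    by rewrite divn1 natZ_n addr0.
  move: (inv x) => /existsPn/(_ (Ordinal q1)); rewrite negbK /a /= muln1 => /eqP e.
  by rewrite -/F !Ff e.
have [/existsP[y /existsP[j yj]]|/existsPn inv] :=
    boolP [exists y, exists j : 'I_r, f (y + b j) != f y]; last first.
  right=> k rk; apply: (dft_periodic rn) rk => z.
  have [r1|r1] := leqP r 1.
    have -> : r = 1%N by apply/eqP; rewrite eqn_leq r1.
    by rewrite divn1 natZ_n addr0.
  move: (inv z) => /existsPn/(_ (Ordinal r1)); rewrite negbK /b /= muln1 => /eqP e.
  by rewrite -/F !Ff e.
have f1 z : (f z <= 1)%N by exact: leq_b1.
(* In a parallelogram with values 0 and 1, a jump along one side at [v] rules out a jump along the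
   other. So the jump at [x] in direction [a] makes its coset constant in direction [b], and
   conversely at [y]. *)
have square (u v w t : nat) :
    (u + v = w + t)%N -> w != v -> (u <= 1 -> v <= 1 -> w <= 1 -> t <= 1 -> t = v)%N.
  by move=> ? /eqP; lia.
have invb j' i' : f (x + (a i' + b j')) = f (x + a i').
  have e := square _ _ _ _ (sq x i j') xi (f1 _) (f1 _) (f1 _) (f1 _).
  by have := sq x i' j'; rewrite e => /addIn.
have inva i' j' : f (y + (a i' + b j')) = f (y + b j').
  have := sq y i' j; rewrite [RHS]addnC => sq1.
  have e := square _ _ _ _ sq1 yj (f1 _) (f1 _) (f1 _) (f1 _).
  by have := sq y i' j'; rewrite e addnC => /addnI.
(* The coset of [x] holds [al * r] points and that of [y] a multiple of [q], so [q] divides [al].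
   But exactly one of [f (x + a i)] and [f x] is 1, whence [0 < al < q]. *)
pose al := (\sum_(i < q) f (x + a i)%R)%N.
have sx : s x = (al * r)%N.
  rewrite /s /al big_distrl; apply: eq_bigr => i' _.
  under eq_bigr do rewrite invb.
  by rewrite sum_nat_const card_ord mulnC.
have sy : (q %| s y)%N.
  rewrite /s exchange_big; apply: dvdn_sum => j' _.
  under eq_bigr do rewrite inva.
  by rewrite sum_nat_const card_ord dvdn_mulr.
have qal : (q %| al)%N by move: sy; rewrite -(s_const x) sx Gauss_dvdl.
have a0 : a 0%N = 0 by rewrite /a muln0.
pose i0 := Ordinal q0.
have ii0 : i != i0 by apply: contra xi => /eqP ->; rewrite a0 addr0.
have [] : (0 < al < q)%N.
  have alE : al = (f (x + a i)%R
      + (f x + \sum_(i' < q | (i' != i) && (i' != i0)) f (x + a i')%R))%N.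
    rewrite /al (bigD1 i) //= (bigD1 i0) 1?eq_sym //=.
    by rewrite a0 addr0.
  have bnd : (\sum_(i' < q | (i' != i) && (i' != i0)) f (x + a i')%R <= q - 2)%N.
    apply: (@leq_trans (\sum_(i' < q | (i' != i) && (i' != i0)) 1)%N).
      by apply: leq_sum => i' _; apply: f1.
    have := erefl q; rewrite -{1}(card_ord q) -sum1_card (bigD1 i) //= (bigD1 i0) 1?eq_sym //=.
    by move=> h; rewrite -[X in (_ <= X - _)%N]h addnA (addKn 2).
  have q2 : (1 < q)%N.
    rewrite ltnNge; apply: contra ii0 => q1; apply/eqP/val_inj => /=.
    by have := ltn_ord i; lia.
  have := f1 (x + a i); have := f1 x; rewrite alE.
  by move/eqP: xi; lia.
case/andP => al0 alq.
by have := dvdn_leq al0 qal; rewrite leqNgt alq.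
Qed.

End Vanishing.

(** * Additive functions on the units of Z_N *)

Lemma coprimez_primeP (x : int) N : (0 < N)%N ->
  reflect (forall p, prime p -> (p %| N)%N -> ~~ (p%:Z %| x)%Z) (coprimez x N).
Proof.
move=> N0; apply: (iffP idP) => [cx p pp pN|h].
  apply/negP => px; have : (p %| gcdn `|x| N)%N by rewrite dvdn_gcd pN andbT.
  move: cx; rewrite coprimezE /coprime => /eqP ->; rewrite dvdn1 => /eqP p1.
  by rewrite p1 in pp.
rewrite coprimezE /coprime; apply/negPn/negP => g1.
have /pdivP[p pp] : (1 < gcdn `|x| N)%N by rewrite ltn_neqAle eq_sym g1 gcdn_gt0 N0 orbT.
rewrite dvdn_gcd => /andP[px pN].
by have := h p pp pN; rewrite dvdzE /= px.
Qed.

Lemma coprimez_mod N x y : (0 < N)%N -> (N%:Z %| x - y)%Z -> coprimez x N -> coprimez y N.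
Proof.
move=> N0 xy /(coprimez_primeP _ N0) h; apply/(coprimez_primeP _ N0) => p pp pN.
have pxy : (p%:Z %| x - y)%Z by apply: dvdz_trans xy; rewrite dvdzE.
by have := h p pp pN; rewrite -{1}(subrK y x) (rpredDl _ pxy).
Qed.

Lemma odd_prime_gt2 N p : odd N -> prime p -> (p %| N)%N -> (2 < p)%N.
Proof.
move=> oN pp pN; rewrite ltn_neqAle prime_gt1 // andbT.
by apply: contraTneq oN => p2; move: pN; rewrite -p2 dvdn2.
Qed.

Definition avoids (p : nat) (s : int) (A : seq int) :=
  all (fun a => ~~ (p%:Z %| s - a)%Z) A.

(** Pigeonhole: the integers from 0 to [size A] are pairwise incongruent modulo [p]; if each were
    congruent to a member of [A], the position of the first such member would inject them into
    [size A] places. *)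
Lemma exists_avoids p A : (size A < p)%N -> exists s, avoids p s A.
Proof.
move=> Ap; pose P (i : 'I_(size A).+1) := fun a => (p%:Z %| i%:Z - a)%Z.
have [/existsP[i iA]|/existsPn h] := boolP [exists i, ~~ has (P i) A].
  by exists i%:Z; move: iA; rewrite -all_predC.
have lt i : (find (P i) A < size A)%N by rewrite -has_find; have := h i; rewrite negbK.
pose f i := Ordinal (lt i).
have : injective f.
  move=> i j /(congr1 val) /= e; apply: val_inj => /=.
  have := h i; have := h j; rewrite !negbK => /(nth_find 0) Pj /(nth_find 0) Pi.
  move: Pj; rewrite -e /P => Pj; move: Pi; rewrite /P => Pi.
  have := rpredB Pi Pj; rewrite opprB addrA subrK -eqz_mod_dvd.
  by rewrite !modz_nat !modn_small ?(leq_trans (ltn_ord _)) // => /eqP[].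
by move/leq_card; rewrite !card_ord ltnn.
Qed.

Lemma eq_avoids p x y A : (p%:Z %| x - y)%Z -> avoids p x A = avoids p y A.
Proof.
move=> xy; apply: eq_all => a; congr (~~ _).
by rewrite -[RHS](rpredDl _ xy) addrA subrK.
Qed.

(** Only the residue of [s] modulo each prime matters, so local solutions are glued by the Chinese
    remainder theorem along [primes N]. *)
Lemma crt_avoids N A : (0 < N)%N ->
  (forall p, prime p -> (p %| N)%N -> exists s, avoids p s A) ->
  exists s, forall p, prime p -> (p %| N)%N -> avoids p s A.
Proof.
move=> N0 h.
suff [s sP] : exists s, forall p, p \in primes N -> avoids p s A.
  by exists s => p pp pN; apply: sP; rewrite mem_primes pp N0.
have : {subset primes N <= primes N} by [].
have : uniq (primes N) by exact: primes_uniq.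
move: {1 2 4}(primes N) => ps; elim: ps => [|p ps IH] /=; first by exists 0.
move=> /andP[pps ups] sub.
have [||s sP] := IH; first exact: ups.
  by move=> q qps; apply: sub; rewrite inE qps orbT.
have /sub : p \in p :: ps by rewrite inE eqxx.
rewrite mem_primes => /and3P[pp _ pN].
have [x xP] := h p pp pN.
pose M := (\prod_(q <- ps) q)%N.
have cop : coprimez p M.
  rewrite coprimezE /= prime_coprime // /M big_seq.
  apply/negP; elim/big_ind: _ => [|a b ha hb|q qps].
  - by rewrite dvdn1 => /eqP p1; rewrite p1 in pp.
  - by rewrite Euclid_dvdM // => /orP[].
  - have /sub : q \in p :: ps by rewrite inE qps orbT.
    rewrite mem_primes => /andP[qp _]; rewrite dvdn_prime2 // => /eqP pq.
    by rewrite pq qps in pps.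
exists (zchinese p M x s) => q; rewrite inE => /orP[/eqP ->|qps].
  rewrite (eq_avoids _ (y := x)) // -eqz_mod_dvd; apply/eqP.
  exact: zchinese_modl.
rewrite (eq_avoids _ (y := s)) ?sP //.
apply: (@dvdz_trans M); first by rewrite dvdzE /= /M (big_rem q) //= dvdn_mulr.
by rewrite -eqz_mod_dvd; apply/eqP; exact: zchinese_modr.
Qed.

Section UnitsLinear.
Variables (T : zmodType) (N : nat) (phi : int -> T).
Hypotheses (oddN : odd N).
Let unit x := coprimez x N.
Hypothesis phi_mod : forall x y, (N%:Z %| x - y)%Z -> phi x = phi y.
Hypothesis phiD : forall x y, unit x -> unit y -> unit (x + y) ->
  phi (x + y) = phi x + phi y.
Hypothesis phiN : forall x, unit x -> phi (- x) = - phi x.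

Let N0 : (0 < N)%N. Proof. by case: N oddN. Qed.

Let prime_gt4 p : prime p -> (p %| N)%N -> p != 3 -> (4 < p)%N.
Proof.
move=> pp pN p3; have := odd_prime_gt2 oddN pp pN.
by case: p pp pN p3 => [|[|[|[|[|]]]]].
Qed.

Let unitP x : reflect (forall p, prime p -> (p %| N)%N -> ~~ (p%:Z %| x)%Z) (unit x).
Proof. exact: coprimez_primeP. Qed.

Let unit_mod x y : (N%:Z %| x - y)%Z -> unit x -> unit y.
Proof. exact: coprimez_mod. Qed.

Let unitDN x : unit (x + N%:Z) = unit x.
Proof.
apply/idP/idP; apply: unit_mod; first by rewrite addrC addKr dvdzz.
by rewrite opprD addrA subrr sub0r rpredN dvdzz.
Qed.

Let unitN x : unit (- x) = unit x. Proof. by rewrite /unit coprimeNz. Qed.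

Let unit1 : unit 1. Proof. by rewrite /unit coprimezE coprime1n. Qed.
Let unit2 : unit 2. Proof. by rewrite /unit coprimezE /= coprime2n. Qed.
Let unit4 : unit 4.
Proof. by rewrite -[4]/(2 * 2 : int) /unit coprimezMl; apply/andP. Qed.

(* phi (u + t) - phi u does not depend on u: pass from u to u + t through u + s,
   where s avoids finitely many residues modulo each prime factor of N.  Modulo 3
   these residues leave a free class only because 3 divides t. *)
Let step t u v : (3 %| t)%Z -> unit u -> unit (u + t) -> unit v -> unit (v + t) ->
  phi (u + t) - phi u = phi (v + t) - phi v.
Proof.
move=> t3 /[dup] uu /unitP up /[dup] uut /unitP utp /[dup] uv /unitP vp /[dup] uvt /unitP vtp.
(* If 3 divides [N], then [b] is [- u] modulo 3 in either case, so only 0 and [- u] are forbidden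
   and [u] is free. Accordingly [v + t] is reached through [v + s] or through [v + (t - s)]. *)
pose b := if (3 %| v - u)%Z then - v else v + t.
have [||s sP] := @crt_avoids N [:: 0; t; - u; b]; first exact: N0.
  move=> p pp pN; have [p3|p3] := eqVneq p 3; last first.
    by apply: exists_avoids; rewrite prime_gt4.
  exists u; rewrite /avoids /= p3.
  rewrite p3 in pN; have := up 3 isT pN; have := vp 3 isT pN; move: t3.
  by rewrite /b; case: ifP; lia.
have unitB (a : int) x : a \in [:: 0; t; - u; b] -> x = s - a \/ x = a - s -> unit x.
  move=> aA xE; apply/unitP => p pp pN; have /allP/(_ a aA) := sP p pp pN.
  by case: xE => -> //; rewrite -rpredN opprB.
have us : unit s by apply: (unitB 0); rewrite ?inE ?eqxx // subr0; left.
have uts : unit (t - s) by apply: (unitB t); rewrite ?inE ?eqxx ?orbT //; right.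
have uus : unit (u + s) by apply: (unitB (- u)); rewrite ?inE ?eqxx ?orbT // opprK addrC; left.
have E w : unit w -> unit (w + t) -> unit (w + s) -> phi (w + t) - phi w = phi s + phi (t - s).
  move=> uw uwt uws; have e : w + t = (w + s) + (t - s) by ring.
  by rewrite {1}e (phiD uws uts) -?e // (phiD uw us) // [phi w + _]addrC addrAC addrK.
have E' w : unit w -> unit (w + t) -> unit (w + t - s) ->
    phi (w + t) - phi w = phi s + phi (t - s).
  move=> uw uwt uws; have e : w + t = (w + (t - s)) + s by ring.
  have uws' : unit (w + (t - s)) by rewrite addrA.
  by rewrite {1}e (phiD uws' us) -?e // (phiD uw uts) // [phi w + _]addrC addrAC addrK addrC.
rewrite E //; move: unitB; rewrite /b; case: ifP => _ unitB.
  rewrite E //; apply: (unitB (- v)); rewrite ?inE ?eqxx ?orbT // opprK addrC; by left.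
by rewrite E' //; apply: (unitB (v + t)); rewrite ?inE ?eqxx ?orbT //; right.
Qed.

(** By [step] the increment is moved to a base [v] for which [v], [v + 3 j] and [v + 3 j + 3] are
    units, and split there; the last increment of 3 is moved to base 1, where it is
    [phi 4 - phi 1]. *)
Let phi3 (j : nat) u : unit u -> unit (u + 3 * j%:Z) ->
  phi (u + 3 * j%:Z) - phi u = phi 1 *~ (3 * j%:Z).
Proof.
have u1 := unit1; have u2 := unit2; have u4 := unit4.
have e2 : phi 2 = phi 1 *+ 2 by rewrite -[2]/(1 + 1 : int) phiD.
have e4 : phi 4 = phi 1 *+ 4 by rewrite -[4]/(2 + 2 : int) phiD // e2 -mulrnDr.
elim: j u => [|j IH] u uu uj; first by rewrite mulr0 addr0 subrr mulr0z.
pose t : int := 3 * j%:Z.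
have [||v vP] := @crt_avoids N [:: 0; - t; - (t + 3)]; first exact: N0.
  move=> p pp pN; have [p3|p3] := eqVneq p 3; last first.
    by apply: exists_avoids; rewrite ltnW // prime_gt4.
  by exists 1; rewrite /avoids /= p3 /t; lia.
have unitB a : a \in [:: 0; - t; - (t + 3)] -> unit (v - a).
  by move=> aA; apply/unitP => p pp pN; have /allP/(_ a aA) := vP p pp pN.
have uv : unit v by rewrite -[v]subr0; apply: unitB; rewrite inE eqxx.
have uvt : unit (v + t) by rewrite -[t]opprK; apply: unitB; rewrite !inE eqxx orbT.
have uvt3 : unit (v + t + 3).
  by rewrite -addrA -[t + 3]opprK; apply: unitB; rewrite !inE eqxx !orbT.
have tS : 3 * j.+1%:Z = t + 3 by rewrite /t; lia.
have t3 : (3 %| t + 3)%Z by rewrite /t; lia.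
have uvt3' : unit (v + (t + 3)) by rewrite addrA.
rewrite tS in uj *; rewrite (step t3 uu uj uv uvt3') addrA.
rewrite -[_ - phi v](subrKA (phi (v + t))) (@step 3 (v + t) 1) //.
rewrite IH // -[1 + 3]/(4 : int) e4 -[X in _ - X]mulr1n -mulrnBr // mulrzDr addrC.
by [].
Qed.

(** Residue 1 modulo 3 is reached from 1 by [phi3], residue 2 by oddness. A multiple of 3 can be a
    unit only if 3 does not divide [N]; then [x + N] has a nonzero residue and the same value. *)
Lemma units_linear x : unit x -> phi x = phi 1 *~ x.
Proof.
have u1 := unit1.
have main y : unit y -> (3 %| y - 1)%Z -> phi y = phi 1 *~ y.
  move=> uy /dvdzP[j jE]; have {jE}yE : y = 1 + 3 * j by lia.
  case: j yE => j yE.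
    have := @phi3 j 1 u1; rewrite -yE => /(_ uy) /(canRL (subrK _)) ->.
    by rewrite yE addrC mulrzDr mulr1z.
  have e : y + 3 * j.+1%:Z = 1 by rewrite yE NegzE; lia.
  have := @phi3 j.+1 y uy; rewrite e => /(_ u1) /(canRL (subrK _)).
  rewrite (_ : 3 * j.+1%:Z = 1 - y); last by lia.
  rewrite mulrzBr mulr1z => e1; apply/eqP; rewrite -subr_eq0; apply/eqP.
  by apply: (addrI (phi 1)); rewrite addr0 [RHS]e1 -addrA [- _ + _]addrC.
have main2 y : unit y -> ~~ (3 %| y)%Z -> phi y = phi 1 *~ y.
  move=> uy y3; have [y1|y1] := boolP (3 %| y - 1)%Z; first exact: main.
  have := main (- y); rewrite unitN => /(_ uy); rewrite phiN // mulrNz.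
  by move=> e; apply: oppr_inj; apply: e; lia.
move=> ux; have [x3|x3] := boolP (3 %| x)%Z; last exact: main2.
have N3 : ~~ (3 %| N)%N.
  apply/negP => N3; case/negP: (unitP _ ux 3 isT N3).
  exact: x3.
have pD z : phi (z + N%:Z) = phi z by apply: phi_mod; rewrite addrC addKr.
have uD' z : unit (z - N%:Z) = unit z by rewrite -[in RHS](subrK N%:Z z) unitDN.
have pD' z : phi (z - N%:Z) = phi z by rewrite -[in RHS](subrK N%:Z z) pD.
have {}N3 : ~~ (3 %| N%:Z)%Z by [].
(* At least one of [1 - N] and [1 + N] is prime to 3; there [phi] is linear and takes the value
   [phi 1]. *)
have phi1N : phi 1 *~ N%:Z = 0.
  have [N1|N1] := boolP (3 %| 1 + N%:Z)%Z.
    have := main2 (1 - N%:Z); rewrite uD' pD' => /(_ u1 _) e.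
    have {}e : phi 1 = phi 1 *~ (1 - N%:Z) by apply: e; lia.
    by apply: oppr_inj; apply: (addrI (phi 1)); rewrite oppr0 addr0 [RHS]e mulrzBr mulr1z.
  have := main2 (1 + N%:Z); rewrite unitDN pD => /(_ u1 N1).
  by rewrite mulrzDr mulr1z => e; apply: (addrI (phi 1)); rewrite addr0 -e.
rewrite -pD main2 ?unitDN //; last by move: N3 x3; lia.
by rewrite mulrzDr phi1N addr0.
Qed.

Lemma units_torsion : phi 1 *+ N = 0.
Proof.
have e1 : phi (1 + N%:Z) = phi 1 by apply: phi_mod; rewrite addrC addKr.
have := units_linear (x := 1 + N%:Z); rewrite e1 unitDN => /(_ unit1).
by rewrite mulrzDr mulr1z => e; apply: (addrI (phi 1)); rewrite addr0; exact: esym e.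
Qed.

End UnitsLinear.

(** * Gluing linear functions *)

Lemma mulrn_coprime_eq0 (T : zmodType) (x : T) a b :
  (0 < a)%N -> coprime a b -> x *+ a = 0 -> x *+ b = 0 -> x = 0.
Proof.
move=> a0 cab xa xb; have [km kn e _] := egcdnP b a0.
have := congr1 (fun m => x *+ m) e.
by rewrite /= (eqP cab) mulrnDr !(mulnC _ a) !(mulnC _ b) !mulrnA xa xb !mul0rn add0r mulr1n.
Qed.

(** A prime [p] of [s] divides some member [a = p c] of [t]. Cancelling [p] removes [a] if [c = 1]
    and otherwise replaces it by [c > 1], in which case [t] is strictly shorter than [s]. *)
Lemma prod_primes_factor (s t : seq nat) :
  all prime s -> all (leq 2) t -> (\prod_(p <- s) p = \prod_(a <- t) a)%N ->
  (size t <= size s)%N /\ (size t = size s -> all prime t).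
Proof.
elim: s t => [|p s IH] t /=.
  move=> _; case: t => [|a t] //= /andP[a2 _]; rewrite big_nil big_cons => e.
  have := dvdn_mulr (\prod_(j <- t) j) (dvdnn a); rewrite -e dvdn1 => /eqP a1.
  by rewrite a1 in a2.
move=> /andP[pp ps] t2; rewrite big_cons => e.
have [a at_ pa] : exists2 a, a \in t & (p %| a)%N.
  have : (p %| \prod_(a <- t) a)%N by rewrite -e dvdn_mulr.
  elim: (t) => [|a u IHu]; first by rewrite big_nil dvdn1 => /eqP p1; rewrite p1 in pp.
  rewrite big_cons Euclid_dvdM // => /orP[pa|/IHu[b bu pb]].
    by exists a; rewrite ?inE ?eqxx.
  by exists b; rewrite // inE bu orbT.
have p0 := prime_gt0 pp.
rewrite (perm_big _ (perm_to_rem at_)) big_cons /= in e.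
rewrite (perm_all _ (perm_to_rem at_)) /= in t2; case/andP: t2 => a2 t2.
rewrite (perm_size (perm_to_rem at_)) (perm_all _ (perm_to_rem at_)) /=.
move: (rem a t) t2 e => u u2 e.
have [c ac] := dvdnP pa; have {}e : (\prod_(j <- s) j = c * \prod_(j <- u) j)%N.
  by apply/eqP; rewrite -(eqn_pmul2l p0) e ac mulnCA mulnA.
have [c1|c1] := eqVneq c 1%N.
  rewrite c1 mul1n in e; have [le eqs] := IH u ps u2 e.
  by split=> // [[us]]; rewrite ac c1 mul1n pp eqs.
have c2 : (1 < c)%N.
  by rewrite ltn_neqAle eq_sym c1 lt0n; apply: contraTneq a2 => c0; rewrite ac c0.
have [||le _] := IH (c :: u) ps; rewrite ?big_cons //=; first by rewrite c2.
by split=> [|[us]]; [exact: leqW|move: le; rewrite /= us ltnn].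
Qed.

Section Agree.
Variable T : zmodType.
Implicit Types (a b m : nat) (u v : T).

(* In a divisible group this means that u = a x and v = b x for a common x. *)
Definition agree a u b v := forall m, (a %| m)%N -> (b %| m)%N ->
  u *+ (m %/ a) = v *+ (m %/ b).

Lemma divn_chain a b m : (0 < a)%N -> (a %| b)%N -> (b %| m)%N ->
  (m %/ a = (b %/ a) * (m %/ b))%N.
Proof.
move=> a0 /dvdnP[c ->] /dvdnP[d ->]; have [->|c0] := posnP c.
  by rewrite mul0n muln0 !div0n.
by rewrite {1}mulnA !mulnK ?muln_gt0 ?c0 // mulnC.
Qed.

Lemma agree_lcm a u b v : (0 < a)%N -> (0 < b)%N ->
  u *+ (lcmn a b %/ a) = v *+ (lcmn a b %/ b) -> agree a u b v.
Proof.
move=> a0 b0 e m am bm; have lm : (lcmn a b %| m)%N by rewrite dvdn_lcm am.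
rewrite (divn_chain a0 (dvdn_lcml a b) lm) (divn_chain b0 (dvdn_lcmr a b) lm).
by rewrite !mulrnA e.
Qed.

(** Distributivity of the divisibility lattice: the gcd of the two lcms is [lcmn (gcdn a b) c]. *)
Lemma dvdn_gcd_lcm a b c m :
  (gcdn a b %| m)%N -> (c %| m)%N -> (gcdn (lcmn a c) (lcmn b c) %| m)%N.
Proof.
move=> abm cm.
have <- : lcmn (gcdn a b) c = gcdn (lcmn a c) (lcmn b c).
  exact: (@Order.DistrLatticeTheory.joinIl _ natdvd a b c).
by rewrite dvdn_lcm abm.
Qed.

(** Bezout coefficients of [a] and [b] give [w = km u - kn v]. The last clause allows further values
    to be merged in turn. *)
Lemma agree_merge a u b v : (0 < a)%N -> (0 < b)%N -> agree a u b v ->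
  exists w, [/\ u = w *+ (a %/ gcdn a b), v = w *+ (b %/ gcdn a b)
    & forall c t, (0 < c)%N -> agree a u c t -> agree b v c t -> agree (gcdn a b) w c t].
Proof.
move=> a0 b0 ab; set d := gcdn a b.
have d0 : (0 < d)%N by rewrite gcdn_gt0 a0.
have [da db] : (d %| a)%N /\ (d %| b)%N by rewrite dvdn_gcdl dvdn_gcdr.
have [km kn e _] := egcdnP b a0.
have e' : (km * (a %/ d) = kn * (b %/ d) + 1)%N.
  apply/eqP; rewrite -(eqn_pmul2r d0) mulnDl -!mulnA !divnK // mul1n.
  by rewrite e.
have uv : u *+ (b %/ d) = v *+ (a %/ d).
  have := ab (lcmn a b) (dvdn_lcml a b) (dvdn_lcmr a b).
  have la : (lcmn a b = b %/ d * a)%N.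
    by apply/eqP; rewrite -(eqn_pmul2r d0) muln_lcm_gcd mulnAC divnK // mulnC.
  have lb : (lcmn a b = a %/ d * b)%N.
    by apply/eqP; rewrite -(eqn_pmul2r d0) muln_lcm_gcd mulnAC divnK.
  by rewrite {1}la lb !mulnK.
pose w := u *+ km - v *+ kn.
have wu : u = w *+ (a %/ d).
  have e1 : v *+ (kn * (a %/ d)) = u *+ (kn * (b %/ d)).
    by rewrite mulnC mulrnA -uv -mulrnA mulnC.
  by rewrite /w mulrnBl -!mulrnA e1 e' mulrnDr addrAC subrr add0r mulr1n.
have wv : v = w *+ (b %/ d).
  have e1 : u *+ (km * (b %/ d)) = v *+ (km * (a %/ d)).
    by rewrite mulnC mulrnA uv -mulrnA mulnC.
  by rewrite /w mulrnBl -!mulrnA e1 e' mulrnDr addrAC subrr add0r mulr1n.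
exists w; split=> // c t c0 ac bc.
(* The moduli at which [w] and [t] agree are closed under gcd and contain [lcmn a c] and [lcmn b c];
   the gcd of these divides every common multiple of [d] and [c]. *)
pose P m := [/\ (d %| m)%N, (c %| m)%N & w *+ (m %/ d) = t *+ (m %/ c)].
have P1 : P (lcmn a c).
  split; [exact: dvdn_trans (dvdn_lcml _ _)|exact: dvdn_lcmr|].
  rewrite (divn_chain d0 da) ?dvdn_lcml // mulrnA -wu.
  by apply: ac; rewrite ?dvdn_lcml ?dvdn_lcmr.
have P2 : P (lcmn b c).
  split; [exact: dvdn_trans (dvdn_lcml _ _)|exact: dvdn_lcmr|].
  rewrite (divn_chain d0 db) ?dvdn_lcml // mulrnA -wv.
  by apply: bc; rewrite ?dvdn_lcml ?dvdn_lcmr.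
have Pgcd m1 m2 : (0 < m1)%N -> P m1 -> P m2 -> P (gcdn m1 m2).
  move=> m10 [d1 c1 e1] [d2 c2 e2]; split; rewrite ?dvdn_gcd ?d1 ?d2 ?c1 ?c2 //.
  have [k1 k2 ek _] := egcdnP m2 m10; set g := gcdn m1 m2.
  have dg : (d %| g)%N by rewrite dvdn_gcd d1.
  have cg : (c %| g)%N by rewrite dvdn_gcd c1.
  have ed : (k1 * (m1 %/ d) = k2 * (m2 %/ d) + g %/ d)%N.
    by rewrite !muln_divA // ek divnDl // dvdn_mull.
  have ec : (k1 * (m1 %/ c) = k2 * (m2 %/ c) + g %/ c)%N.
    by rewrite !muln_divA // ek divnDl // dvdn_mull.
  apply: (addrI (w *+ (k2 * (m2 %/ d)))); rewrite -mulrnDr -ed.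
  by rewrite mulnC mulrnA e1 -mulrnA mulnC ec mulrnDr mulnC mulrnA -e2 -mulrnA mulnC.
have lac : (0 < lcmn a c)%N by rewrite lcmn_gt0 a0.
have [gd gc ge] := Pgcd _ _ lac P1 P2.
move=> m dm cm; have gm := dvdn_gcd_lcm dm cm.
by rewrite (divn_chain d0 gd gm) (divn_chain c0 gc gm) !mulrnA ge.
Qed.

(** Successive merging along the list. The clause on [c] and [v] serves the induction: it makes the
    value merged so far agree with the next one. *)
Lemma agree_common (t : nat -> T) (gs : seq nat) : gs != [::] ->
  {in gs, forall g, (0 < g)%N} -> {in gs &, forall a b, agree a (t a) b (t b)} ->
  exists d w, [/\ (0 < d)%N, {in gs, forall g, (d %| g)%N /\ t g = w *+ (g %/ d)} &
    forall c v, (0 < c)%N -> {in gs, forall g, agree g (t g) c v} -> agree d w c v].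
Proof.
elim: gs => [//|g gs IH] _ gs0 ag.
have g0 : (0 < g)%N by apply: gs0; rewrite inE eqxx.
have [->|gsn] := eqVneq gs [::].
  exists g, (t g); split=> // [x|c v _ h].
    by rewrite inE => /eqP ->; rewrite divnn g0 mulr1n.
  by apply: h; rewrite inE.
have gs0' : {in gs, forall g, (0 < g)%N}.
  by move=> x xg; apply: gs0; rewrite inE xg orbT.
have ag' : {in gs &, forall a b, agree a (t a) b (t b)}.
  by move=> x y xg yg; apply: ag; rewrite inE ?xg ?yg orbT.
have [d [w [d0 dw agd]]] := IH gsn gs0' ag'.
have dg : agree d w g (t g).
  by apply: agd => // x xg; apply: ag; rewrite inE ?xg ?eqxx ?orbT.
have [w' [ew eg agw]] := agree_merge d0 g0 dg.
have e0 : (0 < gcdn d g)%N by rewrite gcdn_gt0 d0.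
exists (gcdn d g), w'; split=> // [x|c v c0 h].
  rewrite inE => /orP[/eqP -> //|/dw[dx ->]]; rewrite ?dvdn_gcdr //.
  rewrite (dvdn_trans (dvdn_gcdl d g) dx) ew -mulrnA -divn_chain ?dvdn_gcdl //.
by apply: agw => //; [apply: agd => // x xg|]; apply: h; rewrite inE ?xg ?eqxx ?orbT.
Qed.

End Agree.

(** * Additive functions on the support of a set, for odd n *)

Section Extend.
Variables (R : realType) (n : nat).
Hypotheses (n_gt1 : (1 < n)%N) (oddn : odd n).
Variables (E : {set 'Z_n}) (h : 'Z_n -> circle R).
Hypothesis E_n0 : E != set0.

Let F : 'Z_n -> R[i] := fun x => (chi R E x)%:C.
Let A := dft_supp F.

Hypothesis hD : additive_on A h.

Let n0 : (0 < n)%N. Proof. exact: ltnW. Qed.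
Let A0 : 0 \in A. Proof. exact: mem_dft_supp0. Qed.
Let h0 : h 0 = 0. Proof. exact: additive_on0 hD A0. Qed.

Let AN k : (- k \in A) = (k \in A). Proof. exact: mem_dft_suppN. Qed.

Let hN k : k \in A -> h (- k) = - h k.
Proof. by move=> Ak; apply: (addrI (h k)); rewrite -hD ?subrr ?AN. Qed.

Let mem_gcd (k l : 'Z_n) : gcdn k n = gcdn l n -> k \in A -> l \in A.
Proof.
by move=> kl; rewrite !inE; apply: contra => /eqP l0; apply/eqP; apply: dft_chi_gcd l0.
Qed.

Lemma int_natZ (x : int) : exists m : nat, (n%:Z %| x - m%:Z)%Z /\ x%:~R = m%:R :> 'Z_n.
Proof.
have nz : n%:Z != 0 by rewrite eqz_nat -lt0n.
have [m mE] : exists m : nat, (x %% n%:Z)%Z = m%:Z.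
  by exists `|(x %% n%:Z)%Z|%N; rewrite gez0_abs // modz_ge0.
exists m; rewrite -mE; split; first by rewrite -eqz_mod_dvd modz_mod.
rewrite {1}(divz_eq x n%:Z) mE intrD intrM.
by rewrite -[(n%:Z)%:~R]/(n%:R) natZ_n // mulr0 add0r.
Qed.

Lemma gcd_natZ m : gcdn (m%:R : 'Z_n) n = gcdn m n.
Proof. by rewrite val_natZ // gcdn_modl. Qed.

Let mem_unit g (x : int) : (g %| n)%N -> g%:R \in A -> coprimez x (n %/ g)%N ->
  g%:R * x%:~R \in A.
Proof.
move=> gn Ag cx; have [m [xm ->]] := int_natZ x.
have g0 := dvdn_gt0 n0 gn.
have cm : coprime m (n %/ g).
  have : coprimez m (n %/ g)%N.
    apply: coprimez_mod cx; first by rewrite divn_gt0 // dvdn_leq.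
    by apply: dvdz_trans xm; rewrite dvdzE /= -{2}(divnK gn) dvdn_mulr.
  by rewrite coprimezE.
apply: mem_gcd Ag; rewrite -natrM !gcd_natZ (gcdn_idPl gn).
by rewrite -[X in gcdn _ X](divnK gn) (mulnC _ g) -muln_gcdr (eqP cm) muln1.
Qed.

Let odd_div g : (g %| n)%N -> odd (n %/ g).
Proof. by move=> gn; apply: dvdn_odd oddn; rewrite -{2}(divnK gn) dvdn_mulr. Qed.

(** The frequencies having gcd [g] with [n] are [g] times the integers coprime to [n / g]; in this
    parameter [h] is a function on the units modulo [n / g]. *)
Let phi g (x : int) : circle R := h (g%:R * x%:~R).

Let phi_mod g x y : (g %| n)%N -> ((n %/ g)%N%:Z %| x - y)%Z -> phi g x = phi g y.
Proof.
move=> gn /dvdzP[c e]; rewrite /phi -{1}(subrK y x) e.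
rewrite rmorphD mulrDr rmorphM /= mulrCA -[((n %/ g)%N%:Z)%:~R]/((n %/ g)%:R) -natrM.
by rewrite mulnC divnK // natZ_n // mulr0 add0r.
Qed.

Let phiD g x y : (g %| n)%N -> g%:R \in A -> coprimez x (n %/ g)%N ->
  coprimez y (n %/ g)%N -> coprimez (x + y) (n %/ g)%N ->
  phi g (x + y) = phi g x + phi g y.
Proof.
move=> gn Ag cx cy cxy; rewrite /phi rmorphD mulrDr hD ?mem_unit //.
by rewrite -mulrDr -rmorphD mem_unit.
Qed.

Let phiN g x : (g %| n)%N -> g%:R \in A -> coprimez x (n %/ g)%N ->
  phi g (- x) = - phi g x.
Proof. by move=> gn Ag cx; rewrite /phi rmorphN mulrN hN ?mem_unit. Qed.

Let phi1 g : phi g 1 = h g%:R. Proof. by rewrite /phi mulr1. Qed.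

Let class_linear g (x : int) : (g %| n)%N -> g%:R \in A -> coprimez x (n %/ g)%N ->
  h (g%:R * x%:~R) = h g%:R *~ x.
Proof.
move=> gn Ag cx; rewrite -phi1; apply: (units_linear (odd_div gn)) cx.
- by move=> y z; apply: phi_mod.
- by move=> y z; apply: phiD.
- by move=> y; apply: phiN.
Qed.

Let class_torsion g : (g %| n)%N -> g%:R \in A -> h g%:R *+ (n %/ g) = 0.
Proof.
move=> gn Ag; rewrite -phi1; apply: (units_torsion (odd_div gn)).
- by move=> y z; apply: phi_mod.
- by move=> y z; apply: phiD.
- by move=> y; apply: phiN.
Qed.

(** As [n / g] is odd, some [s] is coprime to it together with [s + g' / g]. Adding [g'] to the
    frequency [g s] then stays in the class of [g], where [h] is linear. *)
Let class_dvd g g' : (g %| g')%N -> (g' %| n)%N -> g%:R \in A -> g'%:R \in A ->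
  h g'%:R = h g%:R *+ (g' %/ g).
Proof.
move=> gg' g'n Ag Ag'; have gn := dvdn_trans gg' g'n.
set c := (g' %/ g)%N; have g0 := dvdn_gt0 n0 gn.
have N0 : (0 < n %/ g)%N by rewrite divn_gt0 // dvdn_leq.
have [|s sP] := @crt_avoids (n %/ g) [:: 0; - c%:Z] N0.
  by move=> p pp pN; apply: exists_avoids; apply: odd_prime_gt2 pN; first exact: odd_div.
have us : coprimez s (n %/ g)%N.
  apply/coprimez_primeP => // p pp pN; have /allP/(_ 0) := sP p pp pN.
  by rewrite subr0; apply; rewrite inE eqxx.
have usc : coprimez (s + c%:Z) (n %/ g)%N.
  apply/coprimez_primeP => // p pp pN; have /allP/(_ (- c%:Z)) := sP p pp pN.
  by rewrite opprK; apply; rewrite !inE eqxx orbT.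
have e : g%:R * (s + c%:Z)%:~R = g%:R * s%:~R + g'%:R :> 'Z_n.
  by rewrite intrD mulrDr -[(c%:Z)%:~R]/(c%:R) -natrM mulnC divnK.
have := class_linear gn Ag usc; rewrite e hD ?mem_unit // -?e ?mem_unit //.
by rewrite class_linear // mulrzDr => /addrI.
Qed.

(** By [agree_common] each [h g] is [w *+ (g %/ d)] for a single [w]; dividing [w] by [d] in the
    circle gives the slope. *)
Lemma extend_of_agree :
  (forall g g', (g %| n)%N -> (g' %| n)%N -> g%:R \in A -> g'%:R \in A ->
     agree g (h g%:R) g' (h g'%:R)) ->
  exists L : R, forall k, k \in A -> h k = mod1 (L * (k : nat)%:R).
Proof.
move=> ag; pose gs := [seq g <- divisors n | (g%:R : 'Z_n) \in A].
have gsE g : (g \in gs) = (g%:R \in A) && (g %| n)%N.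
  by rewrite mem_filter -dvdn_divisors.
have [|||d [w [d0 dw _]]] := @agree_common _ (fun g => h g%:R) gs.
(* The list contains [n], whose residue 0 is in the support as [E] is nonempty. *)
- by apply/eqP => gs0; have := gsE n; rewrite gs0 dvdnn natZ_n // A0.
- by move=> g; rewrite gsE => /andP[_] /dvdn_gt0; apply.
- by move=> g g'; rewrite !gsE => /andP[Ag gn] /andP[Ag' g'n]; apply: ag.
have [v vd] := circle_divisible w d0.
have [L LE] := mod1_surj v; exists L => k Ak.
pose g := gcdn k n; have gn : (g %| n)%N by exact: dvdn_gcdr.
have gk : (g %| k)%N by exact: dvdn_gcdl.
have g0 := dvdn_gt0 n0 gn.
have Ag : g%:R \in A.
  by apply: mem_gcd Ak; rewrite gcd_natZ (gcdn_idPl gn).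
have kE : k = g%:R * ((k %/ g)%N%:Z)%:~R.
  by rewrite -[(_%:Z)%:~R]/((k %/ g)%:R) -natrM mulnC divnK // natr_Zp.
have cop : coprimez (k %/ g)%N (n %/ g)%N.
  rewrite coprimezE /= /coprime -(eqn_pmul2r g0) muln_gcdl !divnK // mul1n.
  by [].
rewrite [in LHS]kE class_linear //.
have [dg ->] : (d %| g)%N /\ h g%:R = w *+ (g %/ d) by apply: dw; rewrite gsE Ag.
rewrite -vd LE -pmulrn -!mulrnA -mod1_mulrn -[L *+ _]mulr_natr; congr (mod1 (_ * _%:R)).
by rewrite mulnA (mulnC d) !divnK // mulnC divnK.
Qed.

Let agree_gcd g g' : (g %| n)%N -> (g' %| n)%N -> g%:R \in A -> g'%:R \in A ->
  (gcdn g g')%:R \in A -> agree g (h g%:R) g' (h g'%:R).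
Proof.
move=> gn g'n Ag Ag' Ad m gm g'm.
have d0 : (0 < gcdn g g')%N by rewrite gcdn_gt0 (dvdn_gt0 n0).
rewrite (class_dvd (dvdn_gcdl g g') gn Ad Ag) (class_dvd (dvdn_gcdr g g') g'n Ad Ag').
by rewrite -!mulrnA -!divn_chain ?dvdn_gcdl ?dvdn_gcdr.
Qed.

Let agree_lcm_mem g g' : (g %| n)%N -> (g' %| n)%N -> g%:R \in A -> g'%:R \in A ->
  (lcmn g g')%:R \in A -> agree g (h g%:R) g' (h g'%:R).
Proof.
move=> gn g'n Ag Ag' Al; have ln : (lcmn g g' %| n)%N by rewrite dvdn_lcm gn.
apply: agree_lcm; rewrite ?(dvdn_gt0 n0) //.
by rewrite -(class_dvd (dvdn_lcml g g') ln Ag Al) -(class_dvd (dvdn_lcmr g g') ln Ag' Al).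
Qed.

(** The divisors of a prime power form a chain, so the gcd of two of them is one of the two. *)
Lemma extend_prime_power p e : prime p -> n = (p ^ e)%N ->
  exists L : R, forall k, k \in A -> h k = mod1 (L * (k : nat)%:R).
Proof.
move=> pp nE; apply: extend_of_agree => g g' gn g'n Ag Ag'.
have /(dvdn_pfactor _ _ pp)[i _ gE] : (g %| p ^ e)%N by rewrite -nE.
have /(dvdn_pfactor _ _ pp)[j _ g'E] : (g' %| p ^ e)%N by rewrite -nE.
apply: agree_gcd => //; have [ij|ji] := leqP i j.
  by rewrite (gcdn_idPl _) // gE g'E dvdn_exp2l.
by rewrite (gcdn_idPr _) // gE g'E dvdn_exp2l // ltnW.
Qed.

(** The class of [r] mediates: a single relation [g + g' v = r w] within the support, together with
    torsion, gives the identity at the lcm. *)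
Lemma agree_distinct_primes g g' r : prime g -> prime g' -> prime r -> g != g' ->
  r != g -> r != g' -> n = (g * g' * r)%N ->
  g%:R \in A -> g'%:R \in A -> r%:R \in A -> agree g (h g%:R) g' (h g'%:R).
Proof.
move=> pg pg' pr gg' rg rg' nE Ag Ag' Ar.
have g0 := prime_gt0 pg; have g'0 := prime_gt0 pg'; have r0 := prime_gt0 pr.
have cop x y : prime x -> prime y -> x != y -> coprime x y.
  by move=> px py xy; rewrite prime_coprime // dvdn_prime2.
have gn : (g %| n)%N by rewrite nE -mulnA dvdn_mulr.
have g'n : (g' %| n)%N by rewrite nE mulnAC dvdn_mull.
have rn : (r %| n)%N by rewrite nE dvdn_mull.
have divg : (n %/ g = g' * r)%N by rewrite nE -mulnA mulKn.
have divg' : (n %/ g' = g * r)%N by rewrite nE mulnAC mulnK.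
have divr : (n %/ r = g * g')%N by rewrite nE mulnK.
have [km kn e _] := egcdnP r g'0.
rewrite (eqP (cop _ _ pg' pr _)) 1?eq_sym // in e.
(* As [km * g'] is 1 modulo [r], the product [g' v] is [- g] modulo [r]; the summand [r] keeps [v]
   prime to [g]. *)
pose v := (km * g * r.-1 + r)%N.
have [w wE] : exists w, (g + g' * v = w * r)%N.
  exists (kn * g * r.-1 + g + g')%N.
  have : (g' * (km * g * r.-1) = (kn * r + 1) * g * r.-1)%N by rewrite -e; ring.
  rewrite /v mulnDr => ->; have := prednK r0; move: (r.-1) => s <-; ring.
have ngv : ~~ (g %| v)%N.
  rewrite /v dvdn_addr; last by rewrite -mulnA dvdn_mull // dvdn_mulr.
  by rewrite dvdn_prime2 // eq_sym.
have ndr x : prime x -> x != r -> ~~ (r %| x)%N by move=> px xr; rewrite dvdn_prime2 // eq_sym.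
have nrv : ~~ (r %| v)%N.
  apply: contra (ndr g pg _) => [rv|]; last by rewrite eq_sym.
  have : (r %| g + g' * v)%N by rewrite wE dvdn_mull.
  by rewrite dvdn_addl // dvdn_mull.
have ngw : ~~ (g %| w)%N.
  apply/negP => gw; have : (g %| g + g' * v)%N by rewrite wE dvdn_mulr.
  by rewrite dvdn_addr // Euclid_dvdM // (negPf ngv) orbF dvdn_prime2 // (negPf gg').
have ng'w : ~~ (g' %| w)%N.
  apply/negP => gw; have : (g' %| g + g' * v)%N by rewrite wE dvdn_mulr.
  by rewrite dvdn_addl ?dvdn_mulr // dvdn_prime2 // eq_sym (negPf gg').
have cv : coprimez v%:Z (n %/ g')%N.
  rewrite coprimezE /= divg' coprime_sym coprimeMl !prime_coprime //.
  by rewrite ngv.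
have cw : coprimez w%:Z (n %/ r)%N.
  rewrite coprimezE /= divr coprime_sym coprimeMl !prime_coprime //.
  by rewrite ngw.
have Agv : g'%:R * (v%:Z)%:~R \in A by apply: mem_unit.
have Arw : r%:R * (w%:Z)%:~R \in A by apply: mem_unit.
have sumE : g%:R + g'%:R * (v%:Z)%:~R = r%:R * (w%:Z)%:~R :> 'Z_n.
  by rewrite -!pmulrn -!natrM -natrD wE mulnC.
have hE : h g%:R + h g'%:R *+ v = h r%:R *+ w.
  by have := hD Ag Agv; rewrite sumE => /(_ Arw); rewrite !class_linear.
have tg := class_torsion gn Ag; have tg' := class_torsion g'n Ag'.
have tr := class_torsion rn Ar; rewrite divg in tg; rewrite divg' in tg'; rewrite divr in tr.
apply: agree_lcm => //.
have lE : lcmn g g' = (g * g')%N.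
  by have := muln_lcm_gcd g g'; rewrite (eqP (cop _ _ pg pg' gg')) muln1.
rewrite lE mulKn // mulnK //.
(* The goal is [X = Y]. Both are killed by [r], and the relation multiplied by [g g'] shows that [g]
   kills their difference. *)
set X := h g%:R *+ g'; set Y := h g'%:R *+ g.
have rX : X *+ r = 0 by rewrite -mulrnA.
have rY : Y *+ r = 0 by rewrite -mulrnA.
have gX : X *+ g + Y *+ (g' * v) = 0.
  transitivity ((h g%:R + h g'%:R *+ v) *+ (g * g')).
    by rewrite /X /Y mulrnDl -!mulrnA; congr (_ *+ _ + _ *+ _); ring.
  by rewrite hE -mulrnA mulnC mulrnA tr mul0rn.
have gY : Y *+ g + Y *+ (g' * v) = 0 by rewrite -mulrnDr wE mulnC mulrnA rY mul0rn.
apply/eqP; rewrite -subr_eq0; apply/eqP; apply: (mulrn_coprime_eq0 g0 (b := r)).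
- by apply: cop; rewrite // eq_sym.
- rewrite mulrnBl; apply/eqP; rewrite subr_eq0; apply/eqP.
  by apply: (addIr (Y *+ (g' * v))); rewrite gX gY.
- by rewrite mulrnBl rX rY subrr.
Qed.

Lemma agree_prime_divisors g g' r : prime g -> prime g' -> prime r -> g != g' ->
  n = (g * g' * r)%N ->
  g%:R \in A -> g'%:R \in A -> agree g (h g%:R) g' (h g'%:R).
Proof.
move=> pg pg' pr gg' nE Ag Ag'.
have g0 := prime_gt0 pg; have g'0 := prime_gt0 pg'; have r0 := prime_gt0 pr.
have gn : (g %| n)%N by rewrite nE -mulnA dvdn_mulr.
have g'n : (g' %| n)%N by rewrite nE mulnAC dvdn_mull.
have cgg' : coprime g g' by rewrite prime_coprime // dvdn_prime2.
have lE : lcmn g g' = (g * g')%N by have := muln_lcm_gcd g g'; rewrite (eqP cgg') muln1.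
have [A1|A1] := boolP (1%:R \in A); first by apply: agree_gcd => //; rewrite (eqP cgg').
have [Al|Al] := boolP ((g * g')%:R \in A); first by apply: agree_lcm_mem; rewrite // lE.
have [/and3P[rg rg' Ar]|nr] := boolP [&& r != g, r != g' & r%:R \in A].
  exact: (agree_distinct_primes pg pg' pr).
have Agcd (k : 'Z_n) : k \in A -> (gcdn k n)%:R \in A.
  by apply: mem_gcd; rewrite gcd_natZ (gcdn_idPl (dvdn_gcdr _ _)).
(* A divisor of [n] divisible by neither [g] nor [g'] is 1 or [r]; one divisible by both is [g g']
   or [n]. The cases settled above exclude all but [n], which is the frequency 0. *)
have [H1 H2] : (forall k : 'Z_n, ~~ (g %| k)%N -> ~~ (g' %| k)%N -> dft F k = 0) /\
    (forall k : 'Z_n, (g %| k)%N -> (g' %| k)%N -> k != 0 -> dft F k = 0).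
  split=> k gk g'k; [|move=> k0]; apply/eqP; apply: contraT => Fk.
    have Ak : k \in A by rewrite inE.
    have {}Ak := Agcd k Ak; pose e := gcdn k n.
    have er : (e %| r)%N.
      have ge : ~~ (g %| e)%N by rewrite dvdn_gcd gn andbT.
      have g'e : ~~ (g' %| e)%N by rewrite dvdn_gcd g'n andbT.
      have : (e %| g * (g' * r))%N by rewrite mulnA -nE dvdn_gcdr.
      rewrite Gauss_dvdr; last by rewrite coprime_sym prime_coprime.
      by rewrite Gauss_dvdr // coprime_sym prime_coprime.
    move: er; rewrite dvdn_divisors // => er.
    have /primeP[_ /(_ e)] := pr; rewrite dvdn_divisors // er => /(_ isT)/orP[]/eqP eE.
      by move: A1; rewrite -eE Ak.
    case/negP: nr; rewrite -eE Ak andbT.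
    by apply/andP; split; apply/eqP => ee; [case/negP: gk|case/negP: g'k]; rewrite -ee dvdn_gcdl.
  have Ak : k \in A by rewrite inE.
  have {}Ak := Agcd k Ak; pose e := gcdn k n.
  have ge : (g * g' %| e)%N by rewrite Gauss_dvd // !dvdn_gcd gk g'k gn.
  have [c cE] := dvdnP ge.
  have cr : (c %| r)%N.
    have : (e %| n)%N by exact: dvdn_gcdr.
    by rewrite cE nE mulnC dvdn_pmul2l // muln_gt0 g0.
  have /primeP[_ /(_ c cr)/orP[]/eqP ce] := pr.
    by move: Al; rewrite -[(g * g')%N]mul1n -ce -cE Ak.
  have : (n %| k)%N by rewrite [X in (X %| _)%N]nE mulnC -ce -cE dvdn_gcdl.
  rewrite /dvdn modn_small ?ltZ // => /eqP k00.
  by case/negP: k0; apply/eqP/val_inj.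
have gg'' : (g * g' %| n)%N by rewrite nE dvdn_mulr.
have ndvd x y : (x %| n)%N -> ~~ (x %| y)%N -> ~~ (x %| (y%:R : 'Z_n))%N.
  by move=> xn xy; rewrite val_natZ // /dvdn modn_dvdm.
(* The first alternative removes [g'] from the support and the second removes [g], since neither
   prime divides the other. *)
have [z|z] := chi_coset_dichotomy n_gt1 cgg' gg'' H1 H2.
  move: Ag'; rewrite inE z ?eqxx // ndvd // dvdn_prime2 //.
move: Ag; rewrite inE z ?eqxx // ndvd // dvdn_prime2 // eq_sym //.
Qed.

(** If neither of [g], [g'] divides the other and their lcm is not [n], then [n = d a b r] with
    [g = d a], [g' = d b] and [a], [b], [r] above 1. Three primes leave no room for [d > 1], so [g],
    [g'], [r] are prime. *)
Lemma extend_three_primes (s : seq nat) : (size s <= 3)%N -> all prime s ->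
  n = (\prod_(p <- s) p)%N ->
  exists L : R, forall k, k \in A -> h k = mod1 (L * (k : nat)%:R).
Proof.
move=> s3 ps nE; apply: extend_of_agree => g g' gn g'n Ag Ag'.
have g0 := dvdn_gt0 n0 gn; have g'0 := dvdn_gt0 n0 g'n.
have [gg'|gg'] := boolP (g %| g')%N; first by apply: agree_gcd; rewrite // (gcdn_idPl gg').
have [g'g|g'g] := boolP (g' %| g)%N; first by apply: agree_gcd; rewrite // (gcdn_idPr g'g).
pose l := lcmn g g'; pose d := gcdn g g'.
have ln : (l %| n)%N by rewrite dvdn_lcm gn.
have [lE|lE] := eqVneq l n.
  by apply: agree_lcm_mem => //; rewrite -/l lE natZ_n.
have l0 : (0 < l)%N by rewrite lcmn_gt0 g0.
have d0 : (0 < d)%N by rewrite gcdn_gt0 g0.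
pose a := (g %/ d)%N; pose b := (l %/ g)%N; pose r := (n %/ l)%N.
have gE : (g = d * a)%N by rewrite mulnC divnK // dvdn_gcdl.
have lbE : (l = g * b)%N by rewrite mulnC divnK // dvdn_lcml.
have g'E : (g' = d * b)%N.
  apply/eqP; rewrite -(eqn_pmul2l g0) -(muln_lcm_gcd g g') -/l -/d lbE; apply/eqP; ring.
have nE' : (n = d * a * b * r)%N by rewrite -gE -lbE mulnC divnK.
have gt1 x : (0 < x)%N -> x != 1%N -> (1 < x)%N by case: x => [|[|]].
have a1 : (1 < a)%N.
  apply: gt1; first by rewrite divn_gt0 // dvdn_leq // dvdn_gcdl.
  by apply: contra gg' => /eqP e; rewrite gE e muln1 dvdn_gcdr.
have b1 : (1 < b)%N.
  apply: gt1; first by rewrite divn_gt0 // dvdn_leq // dvdn_lcml.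
  by apply: contra g'g => /eqP e; rewrite g'E e muln1 dvdn_gcdl.
have r1 : (1 < r)%N.
  apply: gt1; first by rewrite divn_gt0 // dvdn_leq.
  by apply: contra lE => /eqP e; rewrite nE' -gE -lbE e muln1.
have d1 : d = 1%N.
  apply/eqP; apply: contraT => /(gt1 _ d0) d1.
  have [] := @prod_primes_factor s [:: d; a; b; r] ps.
  - by rewrite /= d1 a1 b1 r1.
  - by rewrite -nE !big_cons big_nil nE'; ring.
  by move=> /leq_trans/(_ s3).
have [] := @prod_primes_factor s [:: a; b; r] ps.
- by rewrite /= a1 b1 r1.
- by rewrite -nE !big_cons big_nil nE' d1; ring.
move=> s3' /(_ _) pabr; have {s3'} /pabr : size [:: a; b; r] = size s.
  by apply/eqP; rewrite eqn_leq s3'.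
rewrite d1 mul1n in gE; rewrite d1 mul1n in g'E.
rewrite /= -gE -g'E andbT => /and3P[pg pg' pr].
apply: (agree_prime_divisors pg pg' pr) => //.
  by apply: contra gg' => /eqP ->.
by rewrite nE' d1 mul1n -gE -g'E.
Qed.

End Extend.

Theorem theorem4 (R : realType) (n : nat) (n_ge3 : (3 <= n)%N) :
  let i_ := odd_prime_power n \/ product_of_at_most_3_odd_primes n in
  let ii_ := forall E : {set 'Z_n},
    extendable_domain R (dft_supp (fun x => (chi R E x)%:C)) in
  let iii_ := forall (E : {set 'Z_n}) (g : 'Z_n -> R),
    E != set0 ->
    (forall x1 x2 : 'Z_n, deck3 (chi R E) x1 x2 = deck3 g x1 x2) ->
    exists t : 'Z_n, forall x : 'Z_n, g x = chi R E (x - t) in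
  (i_ <-> ii_) /\ (ii_ <-> iii_).
Proof.
have n_gt1 : (1 < n)%N by exact: ltnW.
(* The empty set has empty support and is excluded from (iii), so it is settled apart. *)
have ext0 : extendable_domain R (dft_supp (fun x : 'Z_n => (chi R set0 x)%:C)).
  by move=> h _; exists 0 => k; rewrite dft_supp_set0 // inE.
move=> i_ ii_ iii_; split; split.
- move=> hi E; have [->//|E0] := eqVneq E set0; move=> h hD.
  case: hi => [[p [e [pp op nE]]]|[s [s3 sP nE]]].
    by apply: (extend_prime_power n_gt1 _ E0 hD pp nE); rewrite nE oddX op orbT.
  have ps : all prime s by apply/allP => p /sP/andP[].
  apply: (extend_three_primes n_gt1 _ E0 hD s3 ps nE).
  rewrite nE big_seq; elim/big_ind: _ => // [a b oa ob|p /sP/andP[] //].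
  by rewrite oddM oa.
- move=> hii; have oddn : odd n.
    apply/negPn/negP => ev; have [E] := even_not_extendable R n_gt1 n_ge3 ev.
    by apply; apply: hii.
  have odd_dvd d : (d %| n)%N -> odd d by move=> dn; exact: dvdn_odd dn oddn.
  have four p p' q l : n = (p * p' * q * l)%N -> prime p -> prime p' -> prime q ->
      p != q -> p' != q -> (1 < l)%N -> False.
    move=> nE pp pp' pq pq' p'q l1.
    have [||||E] := four_factors_not_extendable R n_gt1 nE _ _ _ l1.
    - by rewrite prime_coprime // dvdn_prime2.
    - exact: prime_gt1.
    - exact: prime_gt1.
    - by rewrite dvdn_prime2.
    by apply; apply: hii.
  pose p := pdiv n; have pp : prime p by exact: pdiv_prime.
  have n0 : (0 < n)%N by exact: ltnW.
  have pn : (p %| n)%N by exact: pdiv_dvd.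
  have [m cpm nE] := pfactor_coprime pp n0.
  have [m1|m1] := eqVneq m 1%N.
    left; exists p, (logn p n); split=> //; first exact: odd_dvd.
    by rewrite [LHS]nE m1 mul1n.
  right.
  have m0 : (0 < m)%N by rewrite lt0n; apply: contraTneq n0 => mz; rewrite nE mz.
  have mgt1 : (1 < m)%N by rewrite ltn_neqAle eq_sym m1.
  pose q := pdiv m; have pq : prime q by exact: pdiv_prime.
  have qm : (q %| m)%N by exact: pdiv_dvd.
  have qn : (q %| n)%N by rewrite nE dvdn_mulr.
  have npq : p != q.
    by apply: contraTneq cpm => e; rewrite prime_coprime // negbK e.
  have cpq : coprime p q by rewrite prime_coprime // dvdn_prime2.
  have /dvdnP[k kE] : (p * q %| n)%N by rewrite Gauss_dvd // pn.
  have k0 : (0 < k)%N by rewrite lt0n; apply: contraTneq n0 => kz; rewrite kE kz.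
  have [k1|k1] := eqVneq k 1%N.
    exists [:: p; q]; split=> // [x|]; last by rewrite kE k1 !big_cons big_nil mul1n muln1.
    by rewrite !inE => /orP[] /eqP ->; rewrite ?pp ?pq /= odd_dvd.
  have kgt1 : (1 < k)%N by rewrite ltn_neqAle eq_sym k1.
  pose r := pdiv k; have pr : prime r by exact: pdiv_prime.
  have /dvdnP[l lE] : (r %| k)%N by exact: pdiv_dvd.
  have rn : (r %| n)%N by rewrite kE lE; apply/dvdn_mulr/dvdn_mull.
  have l0 : (0 < l)%N by rewrite lt0n; apply: contraTneq k0 => lz; rewrite lE lz.
  have [l1|l1] := eqVneq l 1%N.
    exists [:: p; q; r]; split=> // [x|]; last first.
      by rewrite kE lE l1 !big_cons big_nil mul1n muln1 mulnC mulnA.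
    by rewrite !inE => /or3P[] /eqP ->; rewrite ?pp ?pq ?pr /= odd_dvd.
  have lgt1 : (1 < l)%N by rewrite ltn_neqAle eq_sym l1.
  (* The roles are assigned so that the third prime differs from the first two: it is [p] if
     [r = q], and [q] otherwise. *)
  exfalso; have [rq|rq] := eqVneq r q.
    apply: (four q r p l) => //; first by rewrite kE lE; ring.
    - by rewrite eq_sym.
    - by rewrite rq eq_sym.
  by apply: (four p r q l) => //; rewrite kE lE; ring.
- by move=> hii E g E0; apply: deck3_of_extendable.
- move=> hiii E; have [->//|E0] := eqVneq E set0.
  by apply: extendable_of_deck3 => // g; apply: hiii.
Qed.
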